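(* Let $(X,\mathscr A,\mu)$ be a $\sigma$-finite measure space, let $\phi\colon X\to X$ and $w\colon X\to\mathbb C$ be $\mathscr A$-measurable, and assume that the weighted composition operator $C_{\phi,w}$ is densely defined in $L^2(\mu)$. Then the reciprocal $C_{\phi,w}^\dag$ of $C_{\phi,w}$ satisfies: (i) $\mathcal D(C_{\phi,w}^\dag)=\{f\in L^2(\mu)\colon \mathsf E_{\phi,w}(f_w)\circ\phi^{-1}\in L^2(\mu)\}$, (ii) $C_{\phi,w}^\dag f=\mathsf E_{\phi,w}(f_w)\circ\phi^{-1}$ for $f\in\mathcal D(C_{\phi,w}^\dag)$.
   Context: Notation: $\mathcal D(T)$, $\mathcal N(T)$, $\mathcal R(T)$ are the domain, kernel and range of an operator $T$; $L^2(\mu)$ is the complex Hilbert space of square $\mu$-integrable $\mathscr A$-measurable complex functions on $X$. Conventions: $\frac10=\infty$, $0\cdot\infty=0$. Weighted composition operators. Put $\mu_w(\sigma)=\int_\sigma|w|^2\,d\mu$ and $\mu_w\circ\phi^{-1}(\sigma)=\mu_w(\phi^{-1}(\sigma))$ for $\sigma\in\mathscr A$. If $\mu_w\circ\phi^{-1}$ is absolutely continuous with respect to $\mu$, then $C_{\phi,w}$ is said to be well-defined and is the operator in $L^2(\mu)$ with $\mathcal D(C_{\phi,w})=\{f\in L^2(\mu)\colon w\cdot(f\circ\phi)\in L^2(\mu)\}$, $C_{\phi,w}f=w\cdot(f\circ\phi)$ (it is closed). ''Densely defined'' includes being well-defined. $\mathsf h_{\phi,w}\colon X\to[0,\infty]$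 is the Radon–Nikodym derivative: $\mu_w\circ\phi^{-1}(\Delta)=\int_\Delta\mathsf h_{\phi,w}\,d\mu$ for $\Delta\in\mathscr A$. Conditional expectation. If $C_{\phi,w}$ is densely defined, then for an $\mathscr A$-measurable $f\colon X\to[0,\infty]$, or $f\in L^p(\mu_w)$ with $1\le p<\infty$, $\mathsf E_{\phi,w}(f)$ denotes the conditional expectation of $f$ with respect to the $\sigma$-algebra $\phi^{-1}(\mathscr A)$ and the measure $\mu_w$. The expression $\mathsf E_{\phi,w}(f)\circ\phi^{-1}$ denotes the unique (up to $\mu$-null sets) $\mathscr A$-measurable function $g$ on $X$ such that $g=0$ a.e. $[\mu]$ on $\{\mathsf h_{\phi,w}=0\}$ and $\mathsf E_{\phi,w}(f)=g\circ\phi$ a.e. $[\mu_w]$. For $f\in L^2(\mu)$, $f_w:=\chi_{\{w\neq0\}}\frac fw$ (so $f_w\in L^2(\mu_w)$). Reciprocal. Let $T$ be a linear operator in a Hilbert space $\mathcal H$ with $\mathcal D(T)=\mathcal N(T)\oplus(\mathcal D(T)\cap\mathcal N(T)^\perp)$ (this holds for closed $T$). The reciprocal $T^\dag$ is the unique densely defined operator with domain $\mathcal D(T^\dag)=\mathcal R(T)\oplus\mathcal R(T)^\perp$ such that $TT^\dag f=P_{\overline{\mathcal R(T)}}f$ for $f\in\mathcal D(T^\dag)$, $T^\dag Tg=P_{\mathcal N(T)^\perp}g$ for $g\in\mathcal D(T)$, and $\mathcal N(T^\dag)=\mathcal R(T)^\perp$, where $P_M$ is the orthogonal projection onto the closed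 subspace $M$. *)

(* Defs.v *)
From HB Require Import structures.
From mathcomp Require Import all_boot all_order all_algebra.
From mathcomp Require Import generic_quotient ring_quotient sesquilinear.
From mathcomp Require Import complex.
From mathcomp Require Import all_classical all_reals all_analysis.
From mathcomp Require Import measurable_realfun.
From mathcomp Require Import ring lra.

Set Implicit Arguments.
Unset Strict Implicit.
Unset Printing Implicit Defensive.

Import Order.TTheory GRing.Theory Num.Theory.
Import Normc.
Import numFieldNormedType.Exports.

Local Open Scope classical_set_scope.
Local Open Scope complex_scope.
Local Open Scope ring_scope.

(* C carries its Borel sigma-algebra, obtained from R x R. *)
Definition reim (R : realType) (z : R[i]) : R * R := (complex.Re z, complex.Im z).

HB.instance Definition _ (R : realType) := isPointed.Build R[i] 0.
HB.instance Definition _ (R : realType) :=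
  Measurable.copy R[i] (g_sigma_algebra_preimageType (@reim R)).

Section complex_measurability.
Context d (T : measurableType d) (R : realType).
Implicit Types f g : T -> R[i].

Lemma measurable_reim : measurable_fun setT (@reim R).
Proof. by move=> _ Y mY; exists Y. Qed.

Lemma cmeasurableP f : measurable_fun setT f <->
  measurable_fun setT (fun x => complex.Re (f x)) /\
  measurable_fun setT (fun x => complex.Im (f x)).
Proof.
split=> [mf|[mr mi]].
  have : measurable_fun setT (@reim R \o f).
    exact: measurableT_comp measurable_reim mf.
  by move/measurable_fun_pairP.
have m2 : measurable_fun setT (@reim R \o f) by apply/measurable_fun_pairP.
move=> _ _ [B mB <-]; rewrite !setTI.
by have := m2 measurableT B mB; rewrite setTI.
Qed.

Lemma sqr_normc_reim (z : R[i]) :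
  normc z ^+ 2 = complex.Re z ^+ 2 + complex.Im z ^+ 2.
Proof. by case: z => a b /=; rewrite sqr_sqrtr// addr_ge0 ?sqr_ge0. Qed.

Lemma normc_ge0 (z : R[i]) : 0 <= normc z.
Proof. by case: z => a b /=; rewrite sqrtr_ge0. Qed.

Lemma cmeasurableD f g : measurable_fun setT f -> measurable_fun setT g ->
  measurable_fun setT (f + g).
Proof.
move=> /cmeasurableP[f1 f2] /cmeasurableP[g1 g2]; apply/cmeasurableP; split.
  rewrite (_ : (fun x => _) = (fun x => complex.Re (f x) + complex.Re (g x))).
    exact: measurable_funD.
  by apply/funext => x; rewrite !fctE; case: (f x) (g x) => [a b] [a' b'].
rewrite (_ : (fun x => _) = (fun x => complex.Im (f x) + complex.Im (g x))).
  exact: measurable_funD.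
by apply/funext => x; rewrite !fctE; case: (f x) (g x) => [a b] [a' b'].
Qed.

Lemma cmeasurableM f g : measurable_fun setT f -> measurable_fun setT g ->
  measurable_fun setT (fun x => f x * g x).
Proof.
move=> /cmeasurableP[f1 f2] /cmeasurableP[g1 g2]; apply/cmeasurableP; split.
  rewrite (_ : (fun x => _) = (fun x => complex.Re (f x) * complex.Re (g x)
      - complex.Im (f x) * complex.Im (g x))).
    by apply: measurable_funB; exact: measurable_funM.
  by apply/funext => x; case: (f x) (g x) => [a b] [a' b'].
rewrite (_ : (fun x => _) = (fun x => complex.Re (f x) * complex.Im (g x)
    + complex.Im (f x) * complex.Re (g x))).
  by apply: measurable_funD; exact: measurable_funM.
by apply/funext => x; case: (f x) (g x) => [a b] [a' b'].
Qed.

Lemma cmeasurable_conj f : measurable_fun setT f ->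
  measurable_fun setT (fun x => (f x)^*).
Proof.
move=> /cmeasurableP[f1 f2]; apply/cmeasurableP; split.
  by rewrite (_ : (fun x => _) = (fun x => complex.Re (f x)))//;
     apply/funext => x; case: (f x).
rewrite (_ : (fun x => _) = (fun x => - complex.Im (f x))).
  exact: measurableT_comp.
by apply/funext => x; case: (f x).
Qed.

Lemma measurable_sqr_normc f : measurable_fun setT f ->
  measurable_fun setT (fun x => normc (f x) ^+ 2).
Proof.
move=> /cmeasurableP[f1 f2].
under eq_fun do rewrite sqr_normc_reim.
by apply: measurable_funD; exact: measurable_funX.
Qed.

End complex_measurability.

Section complex_integral.
Context d (T : measurableType d) (R : realType) (mu : {measure set T -> \bar R}).
Implicit Types (D : set T) (f g : T -> R[i]).

Definition cintegrable D f :=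
  mu.-integrable D (fun x => (complex.Re (f x))%:E) /\
  mu.-integrable D (fun x => (complex.Im (f x))%:E).

Definition cintegral D f : R[i] :=
  (\int[mu]_(x in D) complex.Re (f x))%R +i* (\int[mu]_(x in D) complex.Im (f x))%R.

Lemma cintegrableD D f g : measurable D -> cintegrable D f -> cintegrable D g ->
  cintegrable D (fun x => f x + g x).
Proof.
move=> mD [f1 f2] [g1 g2]; split.
  apply: eq_integrable (integrableD mD f1 g1) => // x _ /=.
  by case: (f x) (g x) => [a b] [a' b'].
apply: eq_integrable (integrableD mD f2 g2) => // x _ /=.
by case: (f x) (g x) => [a b] [a' b'].
Qed.

Lemma cintegralD D f g : measurable D -> cintegrable D f -> cintegrable D g ->
  cintegral D (fun x => f x + g x) = cintegral D f + cintegral D g.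
Proof.
move=> mD [f1 f2] [g1 g2]; rewrite /cintegral.
rewrite -[RHS]/((_ + _) +i* (_ + _)); congr (_ +i* _).
  rewrite -RintegralD//; apply: eq_Rintegral => x _.
  by case: (f x) (g x) => [a b] [a' b'].
rewrite -RintegralD//; apply: eq_Rintegral => x _.
by case: (f x) (g x) => [a b] [a' b'].
Qed.

Lemma cintegralZ D (c : R[i]) f : measurable D -> cintegrable D f ->
  cintegral D (fun x => c * f x) = c * cintegral D f.
Proof.
move=> mD [f1 f2]; rewrite /cintegral; case: c => a b.
rewrite -[RHS]/((_ - _) +i* (_ + _)) -!RintegralZl//.
have iZ r h : mu.-integrable D (EFin \o h) ->
    mu.-integrable D (EFin \o (fun x => r * h x)).
  by move=> /(integrableZl mD r); apply: eq_integrable.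
congr (_ +i* _).
  rewrite -RintegralB//; [|exact: iZ|exact: iZ].
  by apply: eq_Rintegral => x _; case: (f x).
rewrite -RintegralD//; [|exact: iZ|exact: iZ].
by apply: eq_Rintegral => x _; case: (f x).
Qed.

Lemma cintegral_conj D f : measurable D -> cintegrable D f ->
  cintegral D (fun x => (f x)^*) = (cintegral D f)^*.
Proof.
move=> mD [f1 f2]; rewrite /cintegral; congr (_ +i* _).
  by apply: eq_Rintegral => x _; case: (f x).
rewrite -[RHS]mulN1r -RintegralZl//.
by apply: eq_Rintegral => x _; case: (f x) => a b /=; rewrite mulN1r.
Qed.

Lemma ae_eq_cintegral f g : measurable_fun setT f -> measurable_fun setT g ->
  {ae mu, forall x, f x = g x} -> cintegral setT f = cintegral setT g.
Proof.
move=> /cmeasurableP[f1 f2] /cmeasurableP[g1 g2] fg.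
rewrite /cintegral /Rintegral; congr (fine _ +i* fine _);
  apply: ae_eq_integral => //; try exact/measurable_EFinP;
  by apply: filterS fg => x -> _.
Qed.

End complex_integral.

Section L2_functions.
Context d (T : measurableType d) (R : realType) (mu : {measure set T -> \bar R}).
Implicit Types f g : T -> R[i].

Definition isL2 f : Prop :=
  measurable_fun setT f /\ (\int[mu]_x (normc (f x) ^+ 2)%:E < +oo)%E.

Lemma isL2P f : isL2 f <->
  measurable_fun setT f /\ mu.-integrable setT (fun x => (normc (f x) ^+ 2)%:E).
Proof.
split=> -[mf fi]; split=> //.
  apply/integrableP; split; first exact/measurable_EFinP/measurable_sqr_normc.
  by under eq_integral do rewrite gee0_abs ?lee_fin ?sqr_ge0//.
move/integrableP : fi => [_].
by under eq_integral do rewrite gee0_abs ?lee_fin ?sqr_ge0//.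
Qed.

Definition L2pred : {pred T -> R[i]} := mem [set f | isL2 f].

Lemma isL2_submod : submod_closed L2pred.
Proof.
split.
  rewrite inE; split; first by apply/cmeasurableP; split.
  by rewrite integral0_eq// => x _; rewrite normc0 expr0n.
move=> c f g; rewrite !inE => -[mf fi] [mg gi]; apply/isL2P; split.
  apply: cmeasurableD => //.
  by apply: (@cmeasurableM _ _ _ (fun=> c)) => //; apply/cmeasurableP; split.
have /isL2P[_ {}fi] : isL2 f by [].
have /isL2P[_ {}gi] : isL2 g by [].
have := integrableD measurableT
  (integrableZl measurableT (2 * normc c ^+ 2) fi) (integrableZl measurableT 2 gi).
apply: le_integrable => //.
  apply/measurable_EFinP/measurable_sqr_normc/cmeasurableD => //.
  by apply: (@cmeasurableM _ _ _ (fun=> c)) => //; apply/cmeasurableP; split.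
move=> x _; rewrite /= lee_fin ger0_norm ?sqr_ge0//.
rewrite ger0_norm ?addr_ge0 ?mulr_ge0 ?sqr_ge0 ?normc_ge0//.
rewrite -mulrA -exprMn -normcM [(c *: f + g) x](_ : _ = c * f x + g x)//.
case: (c * f x) (g x) => [a b] [a' b']; rewrite !sqr_normc_reim/=.
have := sqr_ge0 (a - a'); have := sqr_ge0 (b - b'); nra.
Qed.

HB.instance Definition _ :=
  GRing.isSubmodClosed.Build R[i] (T -> R[i]) L2pred isL2_submod.

Record L2fun := MkL2fun { L2val :> T -> R[i] ; _ : L2val \in L2pred }.

HB.instance Definition _ := [isSub for L2val].
HB.instance Definition _ := [Choice of L2fun by <:].
HB.instance Definition _ := [SubChoice_isSubLmodule of L2fun by <:].

Lemma L2funP (f : L2fun) : isL2 f. Proof. by have := valP f; rewrite inE. Qed.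

End L2_functions.

Section inner_product_norm.
Context (C : numClosedFieldType) (U : lmodType C) (dot : {dot U for @Num.conj C}).
Local Notation "''[' u , v ]" := (dot u%R v%R) : ring_scope.
Local Notation "''[' u ]" := '[u, u] : ring_scope.

Lemma dot_CauchySchwarz u v : `|'[u, v]| ^+ 2 <= '[u] * '[v].
Proof.
have [->|v0] := eqVneq v 0.
  by rewrite !linear0r normr0 expr0n.
pose a := '[u, v] / '[v]; pose u1 := u - a *: v.
have ou : '[u1, v] = 0.
  by rewrite /u1 linearBl/= linearZl_LR/= divfK ?dnorm_eq0// subrr.
have -> : u = u1 + a *: v by rewrite subrK.
rewrite linearDl/= ou add0r linearZl_LR/= hnormDd/=; last first.
  by rewrite linearZr_LR/= ou mulr0.
rewrite dnormZ normrM (ger0_norm (dnorm_ge0 _ _)) exprMn mulrDl.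
by rewrite -[X in _ <= _ + X]mulrA -expr2 lerDr mulr_ge0 ?dnorm_ge0.
Qed.

Lemma dot_triangle u v : sqrtC '[u + v] <= sqrtC '[u] + sqrtC '[v].
Proof.
have s0 x : 0 <= sqrtC '[x] by rewrite sqrtC_ge0 dnorm_ge0.
rewrite -(@ler_pXn2r _ 2)// ?nnegrE ?addr_ge0//.
rewrite sqrrD !sqrtCK dnormD -[in leRHS]addrAC lerD2l.
have [-> //|uv] := eqVneq ('[u, v] + '[u, v]^*) 0.
  by rewrite mulrn_wge0// mulr_ge0.
apply: le_trans (_ : 2 * `|'[u, v]| <= _).
  have rl : '[u, v] + '[u, v]^* \is Num.real.
    by rewrite CrealE rmorphD/= conjCK addrC.
  apply: le_trans (real_ler_norm rl) _.
  by apply: le_trans (ler_normD _ _) _; rewrite norm_conjC mulr_natl mulr2n.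
rewrite -[leRHS]mulr_natl ler_pM2l ?ltr0n//.
rewrite -(@ler_pXn2r _ 2)// ?nnegrE ?mulr_ge0//.
by rewrite exprMn !sqrtCK dot_CauchySchwarz.
Qed.

End inner_product_norm.

Section L2_space.
Context d (T : measurableType d) (R : realType) (mu : {measure set T -> \bar R}).
Local Notation L2fun := (L2fun mu).

Definition L2null : {pred L2fun} := mem [set f : L2fun | {ae mu, forall x, f x = 0}].

Lemma L2null_zmod : zmod_closed L2null.
Proof.
split; first by rewrite inE/=; apply: aeW.
move=> f g; rewrite !inE/= => f0 g0; near=> x.
rewrite -[LHS]/(f x - g x) (near f0 x)// (near g0 x)// subrr//.
Unshelve. all: by end_near. Qed.

HB.instance Definition _ := GRing.isZmodClosed.Build L2fun L2null L2null_zmod.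

Definition L2 : Type := Quotient.quot L2null.
HB.instance Definition _ := GRing.Zmodule.on L2.
HB.instance Definition _ := EqQuotient.on L2.

Definition L2_repr (f : L2) : T -> R[i] := repr f : L2fun.
Coercion L2_repr : L2 >-> Funclass.

Definition L2_class (f : L2fun) : L2 := \pi_L2%qT f.

Lemma L2_classP (f g : L2fun) :
  L2_class f = L2_class g <-> {ae mu, forall x, f x = g x}.
Proof.
split=> [/eqP|fg].
  rewrite -Quotient.idealrBE inE/=; apply: filterS => x /eqP.
  by rewrite -[X in X == _]/(f x - g x) subr_eq0 => /eqP.
apply/eqP; rewrite -Quotient.idealrBE inE/=; apply: filterS fg => x fgx.
by rewrite -[LHS]/(f x - g x) fgx subrr.
Qed.

Lemma L2_reprP (f : L2) : isL2 mu f. Proof. exact: L2funP. Qed.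

Lemma L2_reprK (f : L2) : L2_class (repr f) = f. Proof. exact: reprK. Qed.

Lemma L2_classK (f : L2fun) : {ae mu, forall x, L2_class f x = f x}.
Proof. by apply/L2_classP; rewrite L2_reprK. Qed.

Lemma L2P (f g : L2) : f = g <-> {ae mu, forall x, f x = g x}.
Proof. by rewrite -[f in f = g]L2_reprK -[g in _ = g]L2_reprK; exact: L2_classP. Qed.

Lemma L2_classD (f g : L2fun) : L2_class (f + g) = L2_class f + L2_class g.
Proof. by rewrite /L2_class -[RHS]/(Quotient.add _ _) (Quotient.pi_add L2null). Qed.

Lemma L2D_ae (f g : L2) : {ae mu, forall x, (f + g : L2) x = f x + g x}.
Proof.
apply: filterS (L2_classK (repr f + repr g)) => x.
by rewrite L2_classD !L2_reprK.
Qed.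

Definition L2_scale (c : R[i]) (f : L2) : L2 := L2_class (c *: (repr f : L2fun)).

Lemma L2_scale_ae c f : {ae mu, forall x, L2_scale c f x = c * f x}.
Proof. exact: L2_classK. Qed.

Lemma L2_scaleA a b f : L2_scale a (L2_scale b f) = L2_scale (a * b) f.
Proof.
apply/L2P; near=> x; rewrite (near (L2_scale_ae a (L2_scale b f)) x)//.
by rewrite (near (L2_scale_ae b f) x)// (near (L2_scale_ae (a * b) f) x)// mulrA.
Unshelve. all: by end_near. Qed.

Lemma L2_scale1 : left_id 1 L2_scale.
Proof.
move=> f; apply/L2P; near=> x.
by rewrite (near (L2_scale_ae 1 f) x)// mul1r.
Unshelve. all: by end_near. Qed.

Lemma L2_scaleDr : right_distributive L2_scale +%R.
Proof.
move=> a f g; apply/L2P; near=> x.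
rewrite (near (L2_scale_ae a (f + g)) x)// (near (L2D_ae f g) x)//.
rewrite (near (L2D_ae (L2_scale a f) (L2_scale a g)) x)// mulrDr.
by rewrite (near (L2_scale_ae a f) x)// (near (L2_scale_ae a g) x).
Unshelve. all: by end_near. Qed.

Lemma L2_scaleDl f : {morph L2_scale^~ f : a b / a + b}.
Proof.
move=> a b; apply/L2P; near=> x.
rewrite (near (L2D_ae (L2_scale a f) (L2_scale b f)) x)//.
rewrite (near (L2_scale_ae (a + b) f) x)// mulrDl.
by rewrite (near (L2_scale_ae a f) x)// (near (L2_scale_ae b f) x).
Unshelve. all: by end_near. Qed.

HB.instance Definition _ :=
  GRing.Zmodule_isLmodule.Build R[i] L2 L2_scaleA L2_scale1 L2_scaleDr L2_scaleDl.

Lemma L2Z_ae (c : R[i]) (f : L2) : {ae mu, forall x, (c *: f : L2) x = c * f x}.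
Proof. exact: L2_scale_ae. Qed.

Lemma L20_ae : {ae mu, forall x, (0 : L2) x = 0}.
Proof.
have E : (0 : L2) = L2_class 0 by apply: (addIr (L2_class 0)); rewrite add0r -L2_classD addr0.
by apply: filterS (L2_classK 0) => x; rewrite -E.
Qed.

Lemma isL2_mul_conj (f g : T -> R[i]) : isL2 mu f -> isL2 mu g ->
  cintegrable mu setT (fun x => f x * Num.conj (g x)).
Proof.
move=> fL gL; have [mf _] := fL; have [mg _] := gL.
have /cmeasurableP[m1 m2] :
    measurable_fun setT (fun x => f x * Num.conj (g x)).
  by apply: cmeasurableM => //; exact: cmeasurable_conj.
move: fL gL => /isL2P[_ fi] /isL2P[_ gi].
have ifg := integrableD measurableT fi gi.
split; apply: le_integrable ifg => //; try exact/measurable_EFinP;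
  move=> x _; rewrite /= lee_fin [leRHS]ger0_norm ?addr_ge0 ?sqr_ge0//;
  case: (f x) (g x) => [a b] [a' b']; rewrite !sqr_normc_reim/=;
  rewrite ler_norml;
  have := sqr_ge0 (a - a'); have := sqr_ge0 (b - b');
  have := sqr_ge0 (a + a'); have := sqr_ge0 (b + b');
  have := sqr_ge0 (a - b'); have := sqr_ge0 (b - a');
  have := sqr_ge0 (a + b'); have := sqr_ge0 (b + a'); 
  move=> *; apply/andP; split; nra.
Qed.

Definition L2_dot (f g : L2) : R[i] :=
  cintegral mu setT (fun x => f x * Num.conj (g x)).

Lemma L2_dotE_ae (f g : L2) (u : T -> R[i]) : measurable_fun setT u ->
  {ae mu, forall x, u x = f x * Num.conj (g x)} -> cintegral mu setT u = L2_dot f g.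
Proof.
move=> mu_ h; apply: ae_eq_cintegral => //.
apply: cmeasurableM; first by case: (L2_reprP f).
by apply: cmeasurable_conj; case: (L2_reprP g).
Qed.

Lemma L2_dot_conj f g : L2_dot f g = Num.conj (L2_dot g f).
Proof.
rewrite /L2_dot -[RHS]cintegral_conj//; last by apply: isL2_mul_conj; exact: L2_reprP.
by congr cintegral; apply/funext => x; rewrite rmorphM/= conjCK mulrC.
Qed.

Lemma L2_measurable_mul_conj (f g : L2) : measurable_fun setT (fun x => f x * Num.conj (g x)).
Proof.
apply: cmeasurableM; first by case: (L2_reprP f).
by apply: cmeasurable_conj; case: (L2_reprP g).
Qed.

Lemma L2_dot_linear_l g c (f1 f2 : L2) :
  L2_dot (c *: f1 + f2) g = c * L2_dot f1 g + L2_dot f2 g.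
Proof.
rewrite {2 3}/L2_dot.
have i1 : cintegrable mu setT (fun x => f1 x * Num.conj (g x)).
  by apply: isL2_mul_conj; exact: L2_reprP.
have i2 : cintegrable mu setT (fun x => f2 x * Num.conj (g x)).
  by apply: isL2_mul_conj; exact: L2_reprP.
have i3 : cintegrable mu setT (fun x => c * (f1 x * Num.conj (g x))).
  have : cintegrable mu setT (fun x => (c \*: (f1 : T -> R[i])) x * Num.conj (g x)).
    apply: isL2_mul_conj (L2_reprP g).
    have := rpredZ c (_ : (f1 : T -> R[i]) \in L2pred mu).
    by rewrite !inE; apply; exact: L2_reprP.
  by rewrite (_ : (fun x => (c \*: _) x * _) = (fun x => c * (f1 x * Num.conj (g x))))//;
     apply/funext => x; rewrite mulrA.
rewrite -cintegralZ// -cintegralD//; apply/esym/L2_dotE_ae.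
  apply: (@cmeasurableD _ _ _ (fun x => c * (f1 x * Num.conj (g x)))).
    apply: (@cmeasurableM _ _ _ (fun=> c)); last exact: L2_measurable_mul_conj.
    by apply/cmeasurableP; split.
  exact: L2_measurable_mul_conj.
near=> x.
rewrite (near (L2D_ae (c *: f1) f2) x)// (near (L2Z_ae c f1) x)//.
by rewrite mulrDl mulrA.
Unshelve. all: by end_near. Qed.

Lemma L2_dot_bilinear : bilinear_for ( *%R : GRing.Scale.law _ _ )
  ((@Num.conj R[i]) \; *%R : GRing.Scale.law _ _) L2_dot.
Proof.
split=> [g|f]; first by move=> c f1 f2; exact: L2_dot_linear_l.
move=> c g1 g2.
by rewrite /= L2_dot_conj L2_dot_linear_l rmorphD rmorphM/= -!L2_dot_conj.
Qed.

HB.instance Definition _ := bilinear_isBilinear.Build R[i] L2 L2 R[i]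
  ( *%R ) ((@Num.conj R[i]) \; *%R) L2_dot L2_dot_bilinear.

Lemma L2_dot_hermitian f g : L2_dot f g = (-1) ^+ false * Num.conj (L2_dot g f).
Proof. by rewrite mul1r L2_dot_conj. Qed.

HB.instance Definition _ := isHermitianSesquilinear.Build R[i] L2 false
  (@Num.conj R[i]) L2_dot L2_dot_hermitian.

Lemma L2_dotxx (f : L2) :
  L2_dot f f = (\int[mu]_x (normc (f x) ^+ 2))%R%:C.
Proof.
congr (_ +i* _); first by apply: eq_Rintegral => x _; rewrite sqr_normc_reim;
  case: (f x) => a b /=; rewrite mulrN opprK !expr2.
rewrite -[RHS](_ : (\int[mu]_(x in setT) 0)%R = 0); last first.
  by rewrite /Rintegral integral0.
apply: eq_Rintegral => x _; case: (f x) => a b /=; ring.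
Qed.

Lemma L2_dot_gt0 (f : L2) : f != 0 -> 0 < L2_dot f f.
Proof.
move=> f0; rewrite L2_dotxx ltcR lt_neqAle.
rewrite Rintegral_ge0 ?andbT; last by move=> x _; rewrite sqr_ge0.
apply: contra f0 => /eqP/esym int0; apply/eqP/L2P.
have [mf fi] := L2_reprP f.
have : (\int[mu]_x `|(normc (f x) ^+ 2)%:E| = 0)%E.
  under eq_integral do rewrite gee0_abs ?lee_fin ?sqr_ge0//.
  rewrite -[LHS]fineK ?[fine _]int0// ge0_fin_numE//.
  by apply: integral_ge0 => x _; rewrite lee_fin sqr_ge0.
have msq : measurable_fun setT (fun x => (normc (f x) ^+ 2)%:E).
  exact/measurable_EFinP/measurable_sqr_normc.
move=> /(ae_eq_integral_abs mu measurableT msq) h0.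
near=> x; rewrite (near L20_ae x)//.
have : setT x -> (normc (f x) ^+ 2)%:E = cst 0%E x by near: x; exact: h0.
by move=> /(_ I)[] /eqP; rewrite sqrf_eq0 => /eqP/eq0_normc.
Unshelve. all: by end_near. Qed.

HB.instance Definition _ := isDotProduct.Build R[i] L2 L2_dot L2_dot_gt0.

Lemma L2_norm_triangle (f g : L2) :
  sqrtC (L2_dot (f + g) (f + g)) <= sqrtC (L2_dot f f) + sqrtC (L2_dot g g).
Proof. exact: dot_triangle. Qed.

Lemma L2_normZ (c : R[i]) (f : L2) :
  sqrtC (L2_dot (c *: f) (c *: f)) = `|c| * sqrtC (L2_dot f f).
Proof.
by rewrite dnormZ sqrtCM ?nnegrE ?exprn_ge0 ?dnorm_ge0// sqrCK.
Qed.

Lemma L2_norm_eq0 (f : L2) : sqrtC (L2_dot f f) = 0 -> f = 0.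
Proof. by move/eqP; rewrite sqrt_dnorm_eq0 => /eqP. Qed.

HB.instance Definition _ := Lmodule_isNormed.Build R[i] L2
  L2_norm_triangle L2_normZ L2_norm_eq0.

Lemma L2_normE (f : L2) : `|f| = sqrtC (L2_dot f f). Proof. by []. Qed.

End L2_space.

Section unbounded_operators.
Context (C : numClosedFieldType) (H : normedModType C).

(* A (not necessarily bounded) linear operator in H; only the values of [app]
   on [dom] are meaningful. *)
Record linop := Linop {
  dom : set H ;
  app :> H -> H ;
  dom0 : dom 0 ;
  dom_linear : forall (c : C) x y, dom x -> dom y -> dom (c *: x + y) ;
  app_linear : forall (c : C) x y, dom x -> dom y ->
    app (c *: x + y) = c *: app x + app y }.

HB.instance Definition _ := gen_eqMixin linop.
HB.instance Definition _ := gen_choiceMixin linop.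

Definition linop0 : linop.
Proof.
apply: (@Linop setT (cst 0)) => //= c x y _ _.
by rewrite /cst scaler0 addr0.
Defined.

Definition densely_defined (S : linop) := dense (dom S).

Definition ker (S : linop) : set H := [set f | dom S f /\ S f = 0].

Definition ran (S : linop) : set H := S @` dom S.

Variable dot : {dot H for @Num.conj C}.

Definition orth (M : set H) : set H := [set f | forall m, M m -> dot f m = 0].

Definition sumset (M N : set H) : set H := [set m + n | m in M & n in N].

Definition is_orthproj (M : set H) (f p : H) := M p /\ orth M (f - p).

(* The defining properties of the reciprocal S of T. Both direct sums are
   orthogonal by construction. *)
Definition is_reciprocal (T S : linop) :=
  [/\ dom T = sumset (ker T) (dom T `&` orth (ker T)),
      densely_defined S /\ dom S = sumset (ran T) (orth (ran T)),
      forall f, dom S f -> dom T (S f) /\ is_orthproj (closure (ran T)) f (T (S f)),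
      forall g, dom T g -> dom S (T g) /\ is_orthproj (orth (ker T)) g (S (T g)) &
      ker S = orth (ran T)].

(* The choice does not matter: [is_reciprocal T] determines [dom S] and S on it. *)
Definition reciprocal (T : linop) : linop := xget linop0 [set S | is_reciprocal T S].

End unbounded_operators.

Section weighted_composition_operator.
Context d (T : measurableType d) (R : realType) (mu : {measure set T -> \bar R}).
Context (phi : {mfun T >-> T}) (w : {mfun T >-> R[i]}).

Local Open Scope ereal_scope.

Definition wmeasure (A : set T) : \bar R := \int[mu]_(x in A) (normc (w x) ^+ 2)%:E.

Lemma measurable_wmeasure_density : measurable_fun setT (fun x => (normc (w x) ^+ 2)%:E).
Proof. exact/measurable_EFinP/measurable_sqr_normc. Qed.

Lemma wmeasure0 : wmeasure set0 = 0. Proof. exact: integral_set0. Qed.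

Lemma wmeasure_ge0 A : 0 <= wmeasure A.
Proof. by apply: integral_ge0 => x _; rewrite lee_fin sqr_ge0. Qed.

Lemma wmeasure_sigma_additive : semi_sigma_additive wmeasure.
Proof.
move=> F mF tF mUF; rewrite /wmeasure ge0_integral_bigcup//; last 2 first.
- exact/measurable_funTS/measurable_wmeasure_density.
- by move=> x _; rewrite lee_fin sqr_ge0.
by apply: is_cvg_ereal_nneg_natsum_cond => n _ _; exact: wmeasure_ge0.
Qed.

HB.instance Definition _ := isMeasure.Build _ _ _ wmeasure
  wmeasure0 wmeasure_ge0 wmeasure_sigma_additive.

Definition wco_well_defined := pushforward wmeasure phi `<< mu.

Definition wco_fun (f : T -> R[i]) : T -> R[i] := fun x => (w x * f (phi x))%R.

Lemma measurable_wco_fun f : measurable_fun setT f -> measurable_fun setT (wco_fun f).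
Proof.
by move=> mf; apply: cmeasurableM => //; exact: measurableT_comp.
Qed.

Lemma wco_fun_ae (f g : T -> R[i]) : wco_well_defined ->
  {ae mu, forall x, f x = g x} -> {ae mu, forall x, wco_fun f x = wco_fun g x}.
Proof.
move=> wd [N [mN N0 fgN]].
have mphiN : measurable (phi @^-1` N) by exact: measurable_funPTI.
have wN0 : wmeasure (phi @^-1` N) = 0.
  apply: (wd N) => //.
  by apply/(measure0_null_setP _ mN).
have : \int[mu]_(x in phi @^-1` N) `|(normc (w x) ^+ 2)%:E| = 0.
  by under eq_integral do rewrite gee0_abs ?lee_fin ?sqr_ge0//.
move=> /ae_eq_integral_abs => /(_ mphiN (measurable_funTS measurable_wmeasure_density)).
apply: filterS => x /= h; rewrite /wco_fun.
have [/h[]/eqP|Nx] := pselect (N (phi x)).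
  by rewrite sqrf_eq0 => /eqP/eq0_normc ->; rewrite !mul0r.
by congr (_ * _)%R; apply: contrapT => fg; exact/Nx/fgN.
Qed.

(* The class of g if g is square-integrable, 0 otherwise. *)
Definition L2_of (g : T -> R[i]) : L2 mu := L2_class (insubd (0%R : L2fun mu) g).

Lemma L2_of_ae g : isL2 mu g -> {ae mu, forall x, L2_of g x = g x}.
Proof.
move=> gL; have := L2_classK (insubd (0%R : L2fun mu) g).
apply: filterS => x ->; congr (_ x).
by apply: insubdK; rewrite inE.
Qed.

Local Close Scope ereal_scope.

Definition wco_dom : set (L2 mu) := [set f | isL2 mu (wco_fun f)].
Definition wco_app (f : L2 mu) : L2 mu := L2_of (wco_fun f).

Section operator.
Hypothesis wd : wco_well_defined.


Lemma wco_fun_linear_ae c (f g : L2 mu) : {ae mu, forall x,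
  wco_fun (c *: f + g : L2 mu) x = c * wco_fun f x + wco_fun g x}.
Proof.
have : {ae mu, forall x, (c *: f + g : L2 mu) x = c * f x + g x}.
  near=> x; rewrite (near (L2D_ae (c *: f) g) x)//.
  by rewrite (near (L2Z_ae c f) x).
move/(wco_fun_ae wd); apply: filterS => x ->.
by rewrite /wco_fun mulrDr mulrCA.
Unshelve. all: by end_near. Qed.

Lemma isL2_linear c (u v : T -> R[i]) : isL2 mu u -> isL2 mu v ->
  isL2 mu (fun x => c * u x + v x).
Proof.
move=> uL vL.
have : (c \*: u + v) \in L2pred mu by apply: (isL2_submod mu).2; rewrite inE.
by rewrite inE.
Qed.

Lemma isL2_ae_eq (u v : T -> R[i]) : measurable_fun setT v ->
  {ae mu, forall x, v x = u x} -> isL2 mu u -> isL2 mu v.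
Proof.
move=> mv vu [mf fi]; split=> //; rewrite (le_lt_trans _ fi)//.
rewrite le_eqVlt; apply/orP; left; apply/eqP; apply: ae_eq_integral => //.
- exact/measurable_EFinP/measurable_sqr_normc.
- exact/measurable_EFinP/measurable_sqr_normc.
- by apply: filterS vu => x ->.
Qed.

Lemma wco_dom_linear (c : R[i]) (f g : L2 mu) : wco_dom f -> wco_dom g -> wco_dom (c *: f + g).
Proof.
move=> Df Dg; apply: isL2_ae_eq (wco_fun_linear_ae c f g) _; last exact: isL2_linear.
by apply: measurable_wco_fun; case: (L2_reprP (c *: f + g)).
Qed.

Lemma wco_dom0 : wco_dom 0.
Proof.
apply: (@isL2_ae_eq (fun=> 0)).
- by apply: measurable_wco_fun; case: (L2_reprP (0 : L2 mu)).
- apply: filterS (wco_fun_ae wd (L20_ae mu)) => x ->.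
  by rewrite /wco_fun mulr0.
- by have := (isL2_submod mu).1; rewrite inE.
Qed.

Lemma wco_app_linear (c : R[i]) (f g : L2 mu) : wco_dom f -> wco_dom g ->
  wco_app (c *: f + g) = c *: wco_app f + wco_app g.
Proof.
move=> Df Dg; apply/L2P; near=> x.
rewrite (near (L2_of_ae (wco_dom_linear c Df Dg)) x)// (near (wco_fun_linear_ae c f g) x)//.
rewrite (near (L2D_ae (c *: wco_app f) (wco_app g)) x)// (near (L2Z_ae c (wco_app f)) x)//.
by rewrite (near (L2_of_ae Df) x)// (near (L2_of_ae Dg) x).
Unshelve. all: by end_near. Qed.

Definition wco : linop (L2 mu) := Linop wco_dom0 wco_dom_linear wco_app_linear.

End operator.

Local Open Scope ereal_scope.

(* A version of h_{phi,w}; [cst 0] is a dummy value for [xget], as below. *)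
Definition wco_rnderiv : T -> \bar R := xget (cst 0) [set h |
  [/\ measurable_fun setT h, forall x, 0 <= h x &
      forall A, measurable A -> pushforward wmeasure phi A = \int[mu]_(x in A) h x]].

(* Conditional expectation of f in some L^p(mu_w), 1 <= p < oo, with respect to
   the measure mu_w and the sigma-algebra of the preimages under phi. As f need
   not be integrable, it is tested on preimages of finite mu_w-measure. *)
Definition is_wco_condexp (f e : T -> R[i]) :=
  measurable_fun [set: g_sigma_algebra_preimageType phi] e /\
  forall A, measurable A -> wmeasure (phi @^-1` A) < +oo ->
    cintegrable wmeasure (phi @^-1` A) e /\
    cintegral wmeasure (phi @^-1` A) e = cintegral wmeasure (phi @^-1` A) f.

Definition wco_condexp (f : T -> R[i]) : T -> R[i] :=
  xget (cst 0%R) [set e | is_wco_condexp f e].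

(* The function written e o phi^{-1}; phi need not be invertible. *)
Definition wco_pullback (e : T -> R[i]) : T -> R[i] :=
  xget (cst 0%R) [set g : T -> R[i] |
    [/\ measurable_fun setT g,
        {ae mu, forall x, wco_rnderiv x = 0 -> g x = 0%R} &
        {ae wmeasure, forall x, e x = g (phi x)}]].

Definition wdiv (f : T -> R[i]) : T -> R[i] :=
  fun x => if w x == 0%R then 0%R else (f x / w x)%R.

End weighted_composition_operator.

(* Main.v *)
From HB Require Import structures.
Require Import Defs.
From mathcomp Require Import all_boot all_order all_algebra complex.
From mathcomp Require Import sesquilinear.
From mathcomp Require Import all_classical all_reals all_analysis.
From mathcomp Require Import measurable_realfun.
From mathcomp Require Import ring lra.

Set Implicit Arguments.
Unset Strict Implicit.
Unset Printing Implicit Defensive.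

Import Order.TTheory GRing.Theory Num.Theory.
Import Normc.
Import numFieldNormedType.Exports.

Local Open Scope classical_set_scope.
Local Open Scope ring_scope.

(** Write T for the weighted composition operator, m for the measure with
density |w|^2 with respect to mu, nu for the push-forward of m along phi and
h for the density of nu with respect to mu.

The key remark is that T k depends only on k o phi, seen in L2(m): its norm
is the norm of k o phi in L2(m), that is, of k in L2(nu). Two consequences
carry the proof.

- T k = 0 holds exactly when k vanishes where h is not 0. So the kernel of T
  and its orthogonal complement are the square-integrable functions carried
  by {h = 0} and by {h <> 0}, and the projections onto them are
  multiplications by indicator functions ([wco_kerP], [wco_orth_kerP],
  [wco_dom_decomposition]).

- For f in L2(mu), let g = E(f_w) o phi^-1. Then w (g o phi) is the
  orthogonal projection of f on the closure of the range of T. Indeed, the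
  conditional expectation is the orthogonal projection in L2(m) onto the
  functions of the form k o phi, and passing from m back to mu turns f_w and
  g o phi into f and w (g o phi) ([wco_pullback_condexpP]).

In an inner product space the reciprocal of an operator T has a graph that can
be written down: it relates f to v when v is in the domain of T, v is
orthogonal to the kernel, and f - T v is orthogonal to the range
([reciprocalP]). For the operator at hand these three conditions say that g is
square-integrable and that v = g. In one direction, T g = w (g o phi). In the
other one, both T v and w (g o phi) are the projection of f, so v and g agree
where h is not 0, and both vanish elsewhere ([wco_graphP]).

Two ingredients have to be built. Density of the domain of T yields sets E_n
increasing to the whole space with mu(E_n) and nu(E_n) finite
([wco_exhaustion]); it makes nu sigma-finite, so that h and the conditional
expectations exist and are unique, and it allows a function k to be truncated
to functions in the domain of T ([truncate_approx]). The projection on the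
functions of phi comes from a Radon-Nikodym theorem for sigma-finite measures
([sigma_finite_radon_nikodym], [ge0_projection], [ex_complex_projection]). *)

(** * The reciprocal of an operator in an inner product space *)

Section reciprocal_construction.
Context (C : numClosedFieldType) (H : normedModType C)
  (dot : {dot H for @Num.conj C}).
Hypothesis dot_norm : forall x : H, dot x x = `|x| ^+ 2.
Implicit Types (x y z : H) (M : set H).

Lemma dot_sym x y : dot x y = 0 -> dot y x = 0.
Proof. by move=> /eqP; rewrite hermC ?mul1r/= conjC_eq0 => /eqP. Qed.

Lemma dotxx_eq0 x : dot x x = 0 -> x = 0.
Proof. by move/eqP; rewrite dnorm_eq0 => /eqP. Qed.

Lemma orth_linear M (c : C) x y : orth dot M x -> orth dot M y ->
  orth dot M (c *: x + y).
Proof. by move=> Mx My m Mm; rewrite linearPl/= Mx// My// mulr0 addr0. Qed.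

Lemma orth0 M : orth dot M 0.
Proof. by move=> m _; rewrite linear0l. Qed.

Lemma orthB M x y : orth dot M x -> orth dot M y -> orth dot M (x - y).
Proof. by move=> Mx My m Mm; rewrite linearBl/= Mx// My// subrr. Qed.

(** By Cauchy-Schwarz, [dot x] is continuous, so that orthogonality
to [M] passes to limits. *)
Lemma orth_closure M x : orth dot M x -> orth dot (closure M) x.
Proof.
move=> xM m clm; apply: contrapT => /eqP xm0.
have xm_gt0 : 0 < `|dot x m| by rewrite normr_gt0.
have nx : 0 < `|x| + 1 by rewrite ltr_wpDl.
(* the radius is chosen so that [`|x| * e < `|dot x m|] *)
pose e := `|dot x m| / (`|x| + 1).
have e0 : 0 < e by rewrite divr_gt0.
have [m' [Mm' mm']] := clm _ (nbhsx_ballx m e e0).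
have : `|dot x m| ^+ 2 <= (`|x| * e) ^+ 2.
  have -> : dot x m = dot x (m - m') by rewrite linearBr/= (xM m')// subr0.
  apply: le_trans (dot_CauchySchwarz dot _ _) _.
  rewrite !dot_norm exprMn ler_wpM2l ?exprn_ge0//.
  rewrite lerXn2r ?nnegrE// ?(ltW e0)//; apply: ltW.
  by move: mm'; rewrite -ball_normE.
rewrite ler_pXn2r// ?nnegrE ?mulr_ge0// ?(ltW e0)// => le1.
suff lt1 : `|x| * e < `|dot x m| by rewrite (lt_geF lt1) in le1.
by rewrite /e mulrCA gtr_pMr// ltr_pdivrMr// mul1r ltrDl.
Qed.

Variable T : linop H.
Hypothesis domT : dom T = sumset (ker T) (dom T `&` orth dot (ker T)).
Hypothesis ranT_dense : dense (sumset (ran T) (orth dot (ran T))).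

(** The graph of the reciprocal: [T v] is the component of [f] in
the range of [T], and [v] is the preimage of this component that is orthogonal
to the kernel. *)
Definition reciprocal_graph (f v : H) :=
  [/\ dom T v, orth dot (ker T) v & orth dot (ran T) (f - T v)].

Lemma domB x y : dom T x -> dom T y -> dom T (x - y).
Proof.
by move=> Tx Ty; have := dom_linear (-1) Ty Tx; rewrite scaleN1r addrC.
Qed.

Lemma appB x y : dom T x -> dom T y -> T (x - y) = T x - T y.
Proof.
move=> Tx Ty; have := app_linear (-1) Ty Tx.
by rewrite !scaleN1r (addrC (- y)) (addrC (- T y)).
Qed.

Lemma app0 : T 0 = 0.
Proof. by rewrite -[X in T X](subrr 0) appB ?subrr//; exact: dom0. Qed.

(** Two candidates [v] and [v'] have [T (v - v')] both in the range
and orthogonal to it, hence [v - v'] is both in the kernel and orthogonal to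
it. *)
Lemma reciprocal_graph_fun f v v' :
  reciprocal_graph f v -> reciprocal_graph f v' -> v = v'.
Proof.
move=> [Tv kv rv] [Tv' kv' rv'].
have Tvv' : dom T (v - v') by exact: domB.
have T0 : T (v - v') = 0.
  apply: dotxx_eq0; rewrite {1}appB//.
  rewrite (_ : T v - T v' = (f - T v') - (f - T v)); last first.
    by rewrite opprB addrCA [f - _ - f]addrAC subrr add0r.
  by apply: (orthB rv' rv); exists (v - v').
apply/eqP; rewrite -subr_eq0; apply/eqP/dotxx_eq0.
exact: (orthB kv kv').
Qed.

Lemma reciprocal_graphP f : (exists v, reciprocal_graph f v) <->
  sumset (ran T) (orth dot (ran T)) f.
Proof.
split=> [[v [Tv kv rv]]|[_ [u Tu <-] [n rn <-]]].
  by exists (T v); [exists v|exists (f - T v); rewrite // addrC subrK].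
move: Tu (Tu); rewrite {1}domT => -[k [Tk k0] [v [Tv kv] <-]] Tu.
exists v; split => //.
have -> : T (k + v) = T v.
  by have := app_linear 1 Tk Tv; rewrite !scale1r k0 add0r.
by rewrite addrAC subrr add0r.
Qed.

Definition reciprocal_app (f : H) : H := xget 0 (reciprocal_graph f).

Lemma reciprocal_appP f v : reciprocal_graph f v -> reciprocal_app f = v.
Proof.
move=> fv; apply: (@reciprocal_graph_fun f) => //.
exact: (@xgetI _ 0 (reciprocal_graph f) v).
Qed.

Definition reciprocal_dom : set H := [set f | exists v, reciprocal_graph f v].

Lemma reciprocal_graph_linear (c : C) f g u v :
  reciprocal_graph f u -> reciprocal_graph g v ->
  reciprocal_graph (c *: f + g) (c *: u + v).
Proof.
move=> [Tu ku ru] [Tv kv rv]; split.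
- exact: dom_linear.
- exact: orth_linear.
- rewrite app_linear// opprD addrACA -scalerBr; exact: orth_linear.
Qed.

Lemma reciprocal_graph0 : reciprocal_graph 0 0.
Proof.
split; [exact: dom0|exact: orth0|].
by rewrite app0 subrr; exact: orth0.
Qed.

Lemma reciprocal_dom_linear (c : C) f g :
  reciprocal_dom f -> reciprocal_dom g -> reciprocal_dom (c *: f + g).
Proof.
move=> [u fu] [v gv]; exists (c *: u + v); exact: reciprocal_graph_linear.
Qed.

Lemma reciprocal_app_linear (c : C) f g :
  reciprocal_dom f -> reciprocal_dom g ->
  reciprocal_app (c *: f + g) = c *: reciprocal_app f + reciprocal_app g.
Proof.
move=> [u fu] [v gv]; rewrite (reciprocal_appP fu) (reciprocal_appP gv).
exact/reciprocal_appP/reciprocal_graph_linear.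
Qed.

Definition reciprocal_linop : linop H :=
  Linop (ex_intro _ 0 reciprocal_graph0 : reciprocal_dom 0)
    reciprocal_dom_linear reciprocal_app_linear.

Lemma is_reciprocal_linop : is_reciprocal dot T reciprocal_linop.
Proof.
have domE : reciprocal_dom = sumset (ran T) (orth dot (ran T)).
  by apply/seteqP; split => f; apply reciprocal_graphP.
split => //.
- by split => //; rewrite /densely_defined /= domE.
- move=> f [v fv] /=; rewrite (reciprocal_appP fv).
  case: fv => Tv kv rv; split => //; split.
    by apply: subset_closure; exists v.
  exact: orth_closure.
- move=> g Tg; move: (Tg); rewrite domT => -[k [Tk k0] [v [Tv kv] gE]].
  have gv : reciprocal_graph (T g) v.
    split => //; rewrite -appB// -gE addrK k0; exact: orth0.
  split; first by exists v.
  rewrite /= (reciprocal_appP gv); split => //.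
  by rewrite -gE addrK => u ku; apply: dot_sym; apply: ku.
- apply/seteqP; split => f.
    move=> [[v fv]] /=; rewrite (reciprocal_appP fv) => v0.
    by case: fv => _ _; rewrite v0 app0 subr0.
  move=> rf; have f0 : reciprocal_graph f 0.
    split; [exact: dom0|exact: orth0|by rewrite app0 subr0].
  by split; [exists 0|rewrite /= (reciprocal_appP f0)].
Qed.

(** Any reciprocal kills [f - T v], which is orthogonal to the range,
and sends [T v] to the projection of [v] on the complement of the kernel, which
is [v] itself. *)
Lemma is_reciprocalP (S : linop H) : is_reciprocal dot T S ->
  dom S = reciprocal_dom /\ forall f v, reciprocal_graph f v -> S f = v.
Proof.
move=> [_ [_ domS] _ ST kerS]; split.
  by rewrite domS; apply/seteqP; split => f; apply reciprocal_graphP.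
move=> f v [Tv kv rv].
have [dSf Sf0] : ker S (f - T v) by rewrite kerS.
have [dSTv [k1 k2]] := ST v Tv.
have Sv : S (T v) = v.
  apply/eqP; rewrite eq_sym -subr_eq0; apply/eqP/dotxx_eq0.
  exact/k2/orthB.
have := app_linear 1 dSf dSTv.
by rewrite !scale1r subrK Sf0 add0r Sv.
Qed.

(** The decomposition of the domain of [T] provides the projection on
the complement of the kernel, and the density of the domain of the reciprocal is
the second assumption; on that domain, the projection on the closure of the
range sends [T v + n] to [T v] for [n] orthogonal to the range. *)
Lemma reciprocalP :
  dom (reciprocal dot T) = reciprocal_dom /\
  forall f v, reciprocal_graph f v -> reciprocal dot T f = v.
Proof.
apply: is_reciprocalP; rewrite /reciprocal.
exact: (@xgetI _ _ [set S | is_reciprocal dot T S] _ is_reciprocal_linop).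
Qed.

End reciprocal_construction.

(** * Measures with a density *)

Section density.
Context d (T : measurableType d) (R : realType).
Variables (mu nu : {measure set T -> \bar R}) (h : T -> R).
Hypothesis mh : measurable_fun setT h.
Hypothesis h0 : forall x, 0 <= h x.
Local Open Scope ereal_scope.
Hypothesis nuE : forall A, measurable A -> nu A = \int[mu]_(x in A) (h x)%:E.

Import HBNNSimple.

Let mhE : measurable_fun setT (EFin \o h).
Proof. exact/measurable_EFinP. Qed.

Lemma nnsfun_integral_density (g : {nnsfun T >-> R}) :
  \int[nu]_x (g x)%:E = \int[mu]_x ((g x)%:E * (h x)%:E).
Proof.
have mI r : measurable_fun setT (fun x => (r * \1_(g @^-1` [set r]) x)%:E).
  by apply/measurable_EFinP; exact: measurable_funM.
have gE x : (g x)%:E = \sum_(r \in range g) (r * \1_(g @^-1` [set r]) x)%:E.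
  by rewrite fimfunE -fsumEFin.
under eq_integral do rewrite gE.
rewrite ge0_integral_fsum//; last by move=> r x _; exact: nnfun_muleindic_ge0.
under [RHS]eq_integral => x _.
  rewrite gE ge0_mule_fsuml; last by move=> r; exact: nnfun_muleindic_ge0.
  over.
rewrite ge0_integral_fsum//; last 2 first.
- by move=> r; exact: (emeasurable_funM (mI r) mhE).
- by move=> r x _; rewrite mule_ge0 ?lee_fin ?h0//; exact: nnfun_muleindic_ge0.
apply: eq_fsbigr => r /[!inE] -[t _ <-].
have mA : measurable (g @^-1` [set g t]) by exact: measurable_sfunP.
under eq_integral do rewrite EFinM.
under [RHS]eq_integral do rewrite EFinM -muleA.
have mIA : measurable_fun setT (fun x => (\1_(g @^-1` [set g t]) x)%:E : \bar R).
  exact/measurable_EFinP.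
rewrite ge0_integralZl// ?lee_fin//.
rewrite ge0_integralZl//; last 3 first.
- exact: (emeasurable_funM mIA mhE).
- by move=> x _; rewrite mule_ge0 ?lee_fin.
- by rewrite lee_fin.
rewrite integral_indic// setIT nuE// integral_mkcond; congr (_ * _).
by apply: eq_integral => x _; rewrite muleC epatch_indic.
Qed.

(** Linearity settles simple functions, and monotone convergence
does the rest. The density is real-valued because multiplication by a fixed
extended real is not continuous. *)
Lemma ge0_integral_density (f : T -> \bar R) : measurable_fun setT f ->
  (forall x, 0 <= f x) -> \int[nu]_x f x = \int[mu]_x (f x * (h x)%:E).
Proof.
move=> mf f0; pose g := nnsfun_approx measurableT mf.
have gf x : (g n x)%:E @[n --> \oo] --> f x.
  by apply: cvg_nnsfun_approx => // y _; exact: f0.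
have ndg x : nondecreasing_seq (fun n => (g n x)%:E).
  by move=> m n mn; rewrite lee_fin; exact/lefP/nd_nnsfun_approx.
have mg n : measurable_fun setT (fun x => (g n x)%:E) by exact/measurable_EFinP.
have g0 n x : 0 <= (g n x)%:E by rewrite lee_fin.
rewrite -(_ : (fun x => limn (fun n => (g n x)%:E)) = f); last first.
  by apply/funext => x; exact/cvg_lim.
rewrite monotone_convergence//.
under eq_fun do rewrite nnsfun_integral_density.
rewrite -monotone_convergence//; last 3 first.
- by move=> n; exact: (emeasurable_funM (mg n) mhE).
- by move=> n x _; rewrite mule_ge0 ?lee_fin.
- move=> x _ m n mn; rewrite lee_wpmul2r ?lee_fin//.
  by rewrite -lee_fin; exact: ndg.
apply: eq_integral => x _.
rewrite (cvg_lim _ (gf x))//; apply/cvg_lim => //.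
by apply: cvgeZr => //; exact: gf.
Qed.

Lemma integral_density (f : T -> R) : measurable_fun setT f ->
  \int[nu]_x (f x)%:E = \int[mu]_x (f x * h x)%:E.
Proof.
move=> mf; have mfE : measurable_fun setT (EFin \o f) by exact/measurable_EFinP.
rewrite integralE [RHS]integralE.
rewrite !ge0_integral_density//; [|exact: measurable_funeneg|exact: measurable_funepos].
congr (_ - _); apply: eq_integral => x _.
  rewrite !funeposE -!EFin_max -EFinM; congr (_%:E).
  by rewrite maxr_pMl// mul0r.
rewrite !funenegE -!EFinN -!EFin_max -EFinM; congr (_%:E).
by rewrite maxr_pMl// mul0r mulNr.
Qed.

End density.

Section radon_nikodym.
Context d (T : measurableType d) (R : realType).
Variables (mu nu : {measure set T -> \bar R}).
Local Open Scope ereal_scope.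

(** The space is cut into disjoint pieces of finite [nu]-measure,
and the densities of the restrictions of [nu] to these pieces are added. The
sum has a finite integral over each piece, so it is finite almost everywhere
and can be replaced by a real-valued function. *)
Lemma sigma_finite_radon_nikodym : sigma_finite setT mu ->
  sigma_finite setT nu -> nu `<< mu -> exists h : T -> R,
  [/\ measurable_fun setT h, forall x, (0 <= h x)%R &
      forall A, measurable A -> nu A = \int[mu]_(x in A) (h x)%:E].
Proof.
move=> smu snu numu.
pose mu' : {sigma_finite_measure set T -> \bar R} :=
  HB.pack (Measure.sort mu) (@isSigmaFinite.Build _ _ _ mu smu)
   (@isSFinite.Build _ _ _ mu (sfinite_measure_sigma_finite smu)).
have [F FT /all_and2[mF nuF]] := snu.
pose E := seqDU F.
have mE k : measurable (E k).
  by apply: measurableD => //; exact: bigsetU_measurable.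
have nuE k : nu (E k) < +oo.
  by rewrite (le_lt_trans _ (nuF k))// le_measure ?inE//; exact: subDsetl.
have UE : \bigcup_i E i = [set: T] by rewrite FT [RHS]seqDU_bigcup_eq.
have tE := trivIset_seqDU F.
pose nu_ k : {finite_measure set T -> \bar R} := mfrestr (mE k) (nuE k).
have nu_mu k : nu_ k `<< mu'.
  apply/null_content_dominatesP => A mA muA0; rewrite /= /mfrestr /mrestr.
  have /null_content_dominatesP := numu.
  move=> /(_ A mA muA0) nuA0; apply/eqP; rewrite -measure_le0 -nuA0.
  by rewrite le_measure ?inE//; exact: measurableI.
have [f_ /all_and4[f_0 _ f_i f_E]] :=
  choice (fun k => radon_nikodym_sigma_finite (nu_mu k)).
have mf_ k : measurable_fun setT (f_ k) by exact: measurable_int (f_i k).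
pose f x := \sum_(k <oo) f_ k x.
have mf : measurable_fun setT f by exact: ge0_emeasurable_sum.
have f0 x : 0 <= f x by exact: nneseries_ge0.
have nufE A : measurable A -> nu A = \int[mu]_(x in A) f x.
  move=> mA; rewrite integral_nneseries//; last first.
    by move=> k; exact: measurable_funTS.
  have mAE k : measurable (A `&` E k) by exact: measurableI.
  transitivity (\sum_(k <oo) nu (A `&` E k)).
    rewrite -[in LHS](setIT A) -UE setI_bigcupr measure_bigcup//.
      by apply: eq_eseriesl => k; rewrite in_setT.
    exact: trivIset_setIl.
  by apply: eq_eseriesr => k _; rewrite -[RHS](f_E k A mA).
have ffin : {ae mu, forall x, f x \is a fin_num}.
  have : {ae mu, forall x k, E k x -> f x \is a fin_num}.
    apply/ae_foralln => k; apply: integrable_ae => //.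
    apply/integrableP; split; first exact: measurable_funTS.
    by under eq_integral do rewrite gee0_abs//; rewrite -nufE.
  apply: filterS => x fx; have : (\bigcup_i E i) x by rewrite UE.
  by case=> k _; exact: fx.
exists (fine \o f); split.
- exact: measurableT_comp.
- by move=> x; rewrite fine_ge0.
- move=> A mA; rewrite nufE//; apply: ae_eq_integral => //.
  + exact: measurable_funTS.
  + by apply/measurable_EFinP; apply: measurable_funTS; exact: measurableT_comp.
  + by apply: filterS ffin => x fx _ /=; rewrite fineK.
Qed.

End radon_nikodym.

(** * Projection of L2 onto the functions of phi *)

Section square_integrable.
Context d (T : measurableType d) (R : realType) (m : {measure set T -> \bar R}).
Implicit Types f g p : T -> R.

Definition sqint f :=
  measurable_fun setT f /\ m.-integrable setT (fun x => (f x ^+ 2)%:E).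

Lemma sqint_le f g : measurable_fun setT f -> (forall x, `|f x| <= `|g x|) ->
  sqint g -> sqint f.
Proof.
move=> mf fg [mg ig]; split => //; apply: le_integrable ig => //.
  by apply/measurable_EFinP; exact: measurable_funX.
by move=> x _; rewrite !abse_EFin lee_fin !normrX lerXn2r ?nnegrE.
Qed.

Lemma sqintM_integrable f g : sqint f -> sqint g ->
  m.-integrable setT (fun x => (f x * g x)%:E).
Proof.
move=> [mf fi] [mg gi]; apply: le_integrable (integrableD measurableT fi gi) => //.
  by apply/measurable_EFinP; exact: measurable_funM.
move=> x _; rewrite -EFinD !abse_EFin lee_fin [leRHS]ger0_norm ?addr_ge0 ?sqr_ge0//.
by rewrite ler_norml; have := sqr_ge0 (f x - g x); have := sqr_ge0 (f x + g x);
  have := sqr_ge0 (f x); have := sqr_ge0 (g x); move=> *; apply/andP; split; nra.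
Qed.

Lemma sqintB f g : sqint f -> sqint g -> sqint (fun x => f x - g x).
Proof.
move=> fL gL; have := sqintM_integrable fL gL.
case: fL gL => [mf fi] [mg gi] fgi; split; first exact: measurable_funB.
have := integrableD measurableT (integrableZl measurableT (-2) fgi)
  (integrableD measurableT fi gi).
by apply: eq_integrable => // x _; rewrite -EFinM -!EFinD; congr (_%:E); ring.
Qed.

Lemma sqint_funrpos f : sqint f -> sqint f^\+%R.
Proof.
move=> fL; apply: (sqint_le _ _ fL); first exact: measurable_funrpos fL.1.
by move=> x; rewrite /funrpos ger0_norm ?le_max ?lexx ?orbT// ge_max ler_norm/=.
Qed.

Lemma sqint_funrneg f : sqint f -> sqint f^\-%R.
Proof.
move=> fL; apply: (sqint_le _ _ fL); first exact: measurable_funrneg fL.1.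
move=> x; rewrite /funrneg ger0_norm ?le_max ?lexx ?orbT// ge_max.
by rewrite -normrN ler_norm/=.
Qed.

Local Open Scope ereal_scope.

Definition density_measure p of measurable_fun setT p & (forall x, (0 <= p x)%R) :=
  fun A : set T => \int[m]_(x in A) (p x)%:E.

Section density_measure.
Variables (p : T -> R) (mp : measurable_fun setT p) (p0 : forall x, (0 <= p x)%R).
Local Notation dm := (density_measure mp p0).

Let dm0 : dm set0 = 0. Proof. exact: integral_set0. Qed.

Let dm_ge0 A : 0 <= dm A.
Proof. by apply: integral_ge0 => x _; rewrite lee_fin. Qed.

Let dm_sigma_additive : semi_sigma_additive dm.
Proof.
move=> F mF tF mUF; rewrite /density_measure ge0_integral_bigcup//; last 2 first.
- by apply: measurable_funTS; exact/measurable_EFinP.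
- by move=> x _; rewrite lee_fin.
by apply: is_cvg_ereal_nneg_natsum_cond => n _ _; exact: dm_ge0.
Qed.

HB.instance Definition _ := isMeasure.Build _ _ _ dm dm0 dm_ge0 dm_sigma_additive.
End density_measure.

End square_integrable.

Section projection.
Context d d' (X : measurableType d) (Y : measurableType d') (R : realType).
Variables (m : {measure set X -> \bar R}) (phi : {mfun X >-> Y}).
Hypothesis sfnu : sigma_finite setT (pushforward m phi).

(** [E o phi] is the orthogonal projection of [p] in real L2 on the
functions of [phi]. Stating orthogonality against all square-integrable
functions of [phi], rather than against indicators, makes it directly usable
in the inner product of L2. *)
Definition is_projection (p : X -> R) (E : Y -> R) :=
  [/\ measurable_fun setT E, sqint m (E \o phi) &
   forall c : Y -> R, measurable_fun setT c -> sqint m (c \o phi) ->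
     (\int[m]_x ((p x - E (phi x)) * c (phi x)) = 0)%R].

Section nonneg.
Local Open Scope ereal_scope.
Variable p : X -> R.
Hypotheses (pL : sqint m p) (p0 : forall x, (0 <= p x)%R).

(** [E] is the density of the push-forward of [p dm] with respect to
the push-forward of [m]. The former is sigma-finite because of the bound
[p <= 1 + p^2]. *)
Lemma ge0_projection : exists E : Y -> R,
  [/\ measurable_fun setT E, forall y, (0 <= E y)%R &
  forall c : Y -> R, measurable_fun setT c -> (forall y, (0 <= c y)%R) ->
   \int[m]_x (c (phi x) * p x)%:E = \int[m]_x (c (phi x) * E (phi x))%:E].
Proof.
have [mp ip] := pL.
pose mup : {measure set X -> \bar R} := density_measure m mp p0.
pose nu := pushforward m phi; pose nup := pushforward mup phi.
have nup_nu : nup `<< nu.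
  apply/null_content_dominatesP => A mA nuA0.
  have mphiA : measurable (phi @^-1` A) by exact: measurable_funPTI.
  rewrite /nup /pushforward /mup /density_measure.
  apply: null_set_integral => //.
  by apply: measurable_funTS; exact/measurable_EFinP.
have snup : sigma_finite setT nup.
  have [F FT /all_and2[mF nuF]] := sfnu; exists F => // k; split => //.
  have mphiF : measurable (phi @^-1` F k) by exact: measurable_funPTI.
  rewrite /nup /pushforward /mup /density_measure.
  have mpF D : measurable_fun D (EFin \o p).
    by apply: measurable_funTS; exact/measurable_EFinP.
  have mpF2 D : measurable_fun D (fun x => (p x ^+ 2)%:E).
    by apply: measurable_funTS; apply/measurable_EFinP; exact: measurable_funX.
  apply: (@le_lt_trans _ _ (\int[m]_(x in phi @^-1` F k) (1 + (p x ^+ 2)%:E))).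
    apply: ge0_le_integral => //.
    - by move=> x _; rewrite lee_fin.
    - by apply: emeasurable_funD.
    - move=> x _; rewrite -EFinD lee_fin.
      by have := sqr_ge0 (p x); have := sqr_ge0 (p x - 1)%R; rewrite !expr2; nra.
  rewrite ge0_integralD//; last by move=> x _; rewrite lee_fin sqr_ge0.
  rewrite integral_cst// mul1e lte_add_pinfty//; first exact: nuF.
  have := integrableS measurableT mphiF (@subsetT _ _) ip.
  move=> /integrableP[_].
  by under eq_integral do rewrite gee0_abs ?lee_fin ?sqr_ge0//.
have [E [mE E0 EE]] := sigma_finite_radon_nikodym sfnu snup nup_nu.
exists E; split => // c mc c0.
have mcE : measurable_fun setT (EFin \o c) by exact/measurable_EFinP.
transitivity (\int[nup]_y (c y)%:E).
  rewrite [RHS]ge0_integral_pushforward//.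
  rewrite [RHS](@ge0_integral_density _ _ _ m mup p)//.
    exact: measurableT_comp mcE _.
    by move=> x /=; rewrite lee_fin.
  by move=> y _; rewrite lee_fin.
rewrite [LHS](ge0_integral_density mE E0 EE)//.
rewrite [LHS]ge0_integral_pushforward//.
- by apply/measurable_EFinP; exact: measurable_funM.
- by move=> y _; rewrite mule_ge0 ?lee_fin.
Qed.

(** Test the defining identity against a truncation [c] of [E] that
is bounded and supported on a set of finite measure. As [c <= E],
[2 \int c^2 <= 2 \int c E = 2 \int c p <= \int c^2 + \int p^2],
and the finite term [\int c^2] cancels. The bound [\int p^2] obtained in this
way passes to the limit. *)
Lemma ge0_projection_sqint (E : Y -> R) : measurable_fun setT E ->
  (forall y, (0 <= E y)%R) ->
  (forall c : Y -> R, measurable_fun setT c -> (forall y, (0 <= c y)%R) ->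
   \int[m]_x (c (phi x) * p x)%:E = \int[m]_x (c (phi x) * E (phi x))%:E) ->
  sqint m (E \o phi).
Proof.
move=> mE E0 EP; have mEphi : measurable_fun setT (E \o phi) by exact: measurableT_comp.
have [mp ip] := pL.
have [F [FT ndF /all_and2[mF nuF]]] := (sigma_finiteP _ _).1 sfnu.
pose c n y := (Num.min (E y) n%:R * \1_(F n) y)%R.
have mc n : measurable_fun setT (c n).
  by apply: measurable_funM; [exact: measurable_minr|exact: measurable_indic].
have c0 n y : (0 <= c n y)%R by rewrite mulr_ge0// le_min E0 ler0n.
have cE n y : (c n y <= E y)%R.
  rewrite /c indicE; case: (_ \in _); rewrite ?mulr1 ?mulr0// ge_min lexx//.
have ndc i j y : (i <= j)%N -> (c i y <= c j y)%R.
  move=> ij; rewrite /c ler_pM ?le_min ?E0 ?ler0n//.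
    by rewrite !ge_min lexx/= ler_nat ij orbT.
  rewrite !indicE; have := ndF i j ij => /subsetPset Fij.
  by have [/set_mem/Fij/mem_set -> //|] := boolP (y \in F i).
have mc2 n : measurable_fun setT (fun x => (c n (phi x) ^+ 2)%:E).
  apply/measurable_EFinP; apply: measurable_funX.
  exact: (measurableT_comp (mc n)).
have mp2 : measurable_fun setT (fun x => (p x ^+ 2)%:E).
  by apply/measurable_EFinP; exact: measurable_funX.
have bound n : \int[m]_x (c n (phi x) ^+ 2)%:E <= \int[m]_x (p x ^+ 2)%:E.
  (* finite, as [c n] is bounded by [n] and carried by [F n] *)
  have cfin : \int[m]_x (c n (phi x) ^+ 2)%:E \is a fin_num.
    rewrite ge0_fin_numE; last by apply: integral_ge0 => x _; rewrite lee_fin sqr_ge0.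
    apply: (@le_lt_trans _ _ (\int[m]_x (n%:R ^+ 2 * \1_(phi @^-1` F n) x)%:E)).
      apply: ge0_le_integral => //.
      - by move=> x _; rewrite lee_fin sqr_ge0.
      - apply/measurable_EFinP; apply: measurable_funM => //; apply: measurable_indic.
        exact: measurable_funPTI.
      - move=> x _; rewrite lee_fin exprMn !indicE.
        have -> : (x \in phi @^-1` F n) = (phi x \in F n).
          by apply/idP/idP; rewrite !inE.
        case: (_ \in _); rewrite ?expr0n ?mulr0// expr1n !mulr1.
        by rewrite lerXn2r ?nnegrE ?ge_min ?lexx ?orbT// le_min E0 ler0n.
    under eq_integral do rewrite EFinM.
    have mphiF : measurable (phi @^-1` F n) by exact: measurable_funPTI.
    rewrite ge0_integralZl//; last first.
      by apply/measurable_EFinP; exact: measurable_indic.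
    by rewrite integral_indic// setIT lte_mul_pinfty ?lee_fin ?exprn_ge0// nuF.
  rewrite -(leeD2lE _ _ cfin).
  rewrite -ge0_integralD//; [|by move=> x _; rewrite lee_fin sqr_ge0..].
  rewrite -ge0_integralD//; [|by move=> x _; rewrite lee_fin sqr_ge0..].
  have mcphi : measurable_fun setT (fun x => c n (phi x)).
    exact: (measurableT_comp (mc n)).
  have mcp : measurable_fun setT (fun x => (c n (phi x) * p x)%:E).
    by apply/measurable_EFinP; exact: measurable_funM.
  have mcE : measurable_fun setT (fun x => (c n (phi x) * E (phi x))%:E).
    by apply/measurable_EFinP; exact: measurable_funM.
  apply: (@le_trans _ _ (\int[m]_x (2%:E * (c n (phi x) * p x)%:E))).
    rewrite ge0_integralZl//; last by move=> x _; rewrite lee_fin mulr_ge0.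
    rewrite (EP (c n))// -ge0_integralZl//; last first.
      by move=> x _; rewrite lee_fin mulr_ge0.
    apply: ge0_le_integral => //.
    - by move=> x _; rewrite -EFinD lee_fin addr_ge0 ?sqr_ge0.
    - exact: (emeasurable_funD (mc2 n) (mc2 n)).
    - exact: (measurable_funeM 2 mcE).
    - move=> x _; rewrite -EFinD -EFinM lee_fin.
      by have := cE n (phi x); have := c0 n (phi x); rewrite !expr2; nra.
  apply: ge0_le_integral => //.
  - move=> x _; rewrite -EFinM lee_fin.
    by have := c0 n (phi x); have := p0 x; nra.
  - exact: (measurable_funeM 2 mcp).
  - exact: (emeasurable_funD (mc2 n) mp2).
  - move=> x _; rewrite -EFinD -EFinM lee_fin.
    by have := sqr_ge0 (c n (phi x) - p x)%R; rewrite !expr2; nra.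
split => //; apply/integrableP; split.
  by apply/measurable_EFinP; exact: measurable_funX.
have /integrableP[_] := ip.
under eq_integral do rewrite gee0_abs ?lee_fin ?sqr_ge0//.
under [X in _ -> X < _]eq_integral do rewrite gee0_abs ?lee_fin ?sqr_ge0//.
apply: le_lt_trans.
have -> : \int[m]_x ((E \o phi) x ^+ 2)%:E =
    \int[m]_x (limn (fun n => (c n (phi x) ^+ 2)%:E)).
  apply: eq_integral => x _; apply/esym/cvg_lim => //; apply: cvg_near_cst.
  have [k _ Fk] : (\bigcup_i F i) (phi x) by rewrite -FT.
  near=> n; rewrite /c indicE mem_set ?mulr1; last first.
    have kn : (k <= n)%N by near: n; exists k.
    by have /subsetPset Fkn := ndF k n kn; exact: Fkn.
  rewrite (min_idPl _)//; near: n; exact: nbhs_infty_ger.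
rewrite monotone_convergence//.
- apply: lime_le; last exact: nearW.
  apply: ereal_nondecreasing_is_cvgn => i j ij.
  apply: ge0_le_integral => //.
  + by move=> x _; rewrite lee_fin sqr_ge0.
  + by move=> x _; rewrite lee_fin lerXn2r ?nnegrE ?c0 ?ndc.
- by move=> n x _; rewrite lee_fin sqr_ge0.
- by move=> x _ i j ij; rewrite lee_fin lerXn2r ?nnegrE ?c0 ?ndc.
Unshelve. all: by end_near. Qed.

End nonneg.

End projection.

Section real_projection.
Context d d' (X : measurableType d) (Y : measurableType d') (R : realType).
Variables (m : {measure set X -> \bar R}) (phi : {mfun X >-> Y}).
Hypothesis sfnu : sigma_finite setT (pushforward m phi).

(** The identity known for nonnegative test functions extends to
real ones by splitting into positive and negative parts; square-integrability
makes all the terms finite. *)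
Lemma nonneg_is_projection (p : X -> R) : sqint m p -> (forall x, 0 <= p x) ->
  exists E, is_projection m phi p E.
Proof.
move=> pL p0; have [E [mE E0 EP]] := ge0_projection sfnu pL p0.
have EL := ge0_projection_sqint sfnu pL p0 mE E0 EP.
exists E; split => //.
pose I (c : Y -> R) := (\int[m]_x ((p x - E (phi x)) * c (phi x)))%R.
have iE c : sqint m (c \o phi) ->
    m.-integrable setT (EFin \o (fun x => (p x - E (phi x)) * c (phi x))).
  by move=> cL; apply: (sqintM_integrable (sqintB pL EL) cL).
have I0 c : measurable_fun setT c -> sqint m (c \o phi) -> (forall y, 0 <= c y) -> I c = 0.
  move=> mc cL c0; rewrite /I.
  under eq_Rintegral => x _ do rewrite mulrBl mulrC [X in _ - X]mulrC.
  rewrite RintegralB//; [|exact: (sqintM_integrable cL pL)|exact: (sqintM_integrable cL EL)].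
  by rewrite /Rintegral EP// subrr.
move=> c mc cL.
have Lp : sqint m (c^\+ \o phi) by exact: (sqint_funrpos cL).
have Ln : sqint m (c^\- \o phi) by exact: (sqint_funrneg cL).
rewrite -[RHS](subrr 0) -[X in X - _](I0 _ _ Lp)//; last exact: measurable_funrpos.
rewrite -[X in _ - X](I0 _ _ Ln)//; last exact: measurable_funrneg.
rewrite /I -RintegralB//; [|exact: iE..].
apply: eq_Rintegral => x _; rewrite -mulrBr; congr (_ * _).
by rewrite -[in LHS](funrposBneg c).
Qed.

Lemma is_projectionB (p q : X -> R) (E F : Y -> R) : sqint m p -> sqint m q ->
  is_projection m phi p E -> is_projection m phi q F ->
  is_projection m phi (fun x => p x - q x) (fun y => E y - F y).
Proof.
move=> pL qL [mE EL EP] [mF FL FP]; split.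
- exact: measurable_funB.
- exact: (sqintB EL FL).
move=> c mc cL.
have ip := sqintM_integrable (sqintB pL EL) cL.
have iq := sqintM_integrable (sqintB qL FL) cL.
rewrite -[RHS](subrr 0) -[X in X - _](EP c)// -[X in _ - X](FP c)//.
rewrite -RintegralB//; apply: eq_Rintegral => x _ /=; ring.
Qed.

Lemma ex_projection (p : X -> R) : sqint m p ->
  exists E, is_projection m phi p E.
Proof.
move=> pL.
have [E EP] := nonneg_is_projection (sqint_funrpos pL) (funrpos_ge0 p).
have [F FP] := nonneg_is_projection (sqint_funrneg pL) (funrneg_ge0 p).
exists (fun y => E y - F y).
have := is_projectionB (sqint_funrpos pL) (sqint_funrneg pL) EP FP.
by rewrite (_ : (fun x => p^\+ x - p^\- x) = p)// -[RHS](funrposBneg p).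
Qed.

End real_projection.

Section complex_L2.
Context d (X : measurableType d) (R : realType) (m : {measure set X -> \bar R}).
Implicit Types q : X -> R[i].

Lemma isL2_sqint q : isL2 m q <->
  sqint m (fun x => complex.Re (q x)) /\ sqint m (fun x => complex.Im (q x)).
Proof.
split=> [/isL2P[/cmeasurableP[m1 m2] qi]|[[m1 i1] [m2 i2]]].
  split; split => //; apply: le_integrable qi => //.
  - by apply/measurable_EFinP; exact: measurable_funX.
  - move=> x _; rewrite lee_fin !ger0_norm ?sqr_ge0// sqr_normc_reim.
    by rewrite lerDl sqr_ge0.
  - by apply/measurable_EFinP; exact: measurable_funX.
  - move=> x _; rewrite lee_fin !ger0_norm ?sqr_ge0// sqr_normc_reim.
    by rewrite lerDr sqr_ge0.
apply/isL2P; split; first exact/cmeasurableP.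
have := integrableD measurableT i1 i2.
by apply: eq_integrable => // x _; rewrite sqr_normc_reim.
Qed.

Lemma isL2_complex (a b : X -> R) : sqint m a -> sqint m b ->
  isL2 m (fun x => (a x +i* b x)%C).
Proof. by move=> aL bL; apply/isL2_sqint. Qed.

Lemma isL2B q r : isL2 m q -> isL2 m r -> isL2 m (fun x => q x - r x).
Proof.
move=> /isL2_sqint[q1 q2] /isL2_sqint[r1 r2]; apply/isL2_sqint; split.
  by have := sqintB q1 r1; congr (sqint m _); apply/funext => x;
    case: (q x) (r x) => [? ?] [? ?].
by have := sqintB q2 r2; congr (sqint m _); apply/funext => x;
  case: (q x) (r x) => [? ?] [? ?].
Qed.

Lemma isL2_le q r : measurable_fun setT q -> (forall x, normc (q x) <= normc (r x)) ->
  isL2 m r -> isL2 m q.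
Proof.
move=> mq qr rL; have [mr _] := rL; split => //.
case: rL => _; apply: le_lt_trans; apply: ge0_le_integral => //.
- by move=> x _; rewrite lee_fin sqr_ge0.
- by apply/measurable_EFinP; exact: measurable_sqr_normc.
- by apply/measurable_EFinP; exact: measurable_sqr_normc.
- by move=> x _; rewrite lee_fin lerXn2r ?nnegrE ?normc_ge0.
Qed.

Lemma isL2_indic (A : set X) : measurable A -> (m A < +oo)%E ->
  isL2 m (fun x => (\1_A x)%:C%C : R[i]).
Proof.
move=> mA mAoo; split.
  by apply/cmeasurableP; split => //=; exact: measurable_indic.
rewrite (_ : (\int[m]_x _ = m A)%E)//.
under eq_integral => x _.
  rewrite (_ : normc _ ^+ 2 = \1_A x); first over.
  by rewrite sqr_normc_reim/= indicE; case: (_ \in _); rewrite ?expr0n/= addr0 ?expr1n.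
by rewrite integral_indic// setIT.
Qed.

End complex_L2.

Section complex_projection.
Context d d' (X : measurableType d) (Y : measurableType d') (R : realType).
Variables (m : {measure set X -> \bar R}) (phi : {mfun X >-> Y}).
Hypothesis sfnu : sigma_finite setT (pushforward m phi).

(** Real and imaginary parts are projected separately: the real and
imaginary parts of the inner product are combinations of four real inner
products, each of which vanishes. *)
Lemma ex_complex_projection (q : X -> R[i]) : isL2 m q -> exists g : Y -> R[i],
  [/\ measurable_fun setT g, isL2 m (g \o phi) &
   forall u : Y -> R[i], measurable_fun setT u -> isL2 m (u \o phi) ->
     cintegral m setT (fun x => (q x - g (phi x)) * Num.conj (u (phi x))) = 0].
Proof.
move=> /isL2_sqint[q1 q2].
have [E [mE EL EP]] := ex_projection sfnu q1.
have [F [mF FL FP]] := ex_projection sfnu q2.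
exists (fun y => (E y +i* F y)%C); split.
- by apply/cmeasurableP.
- exact: (isL2_complex EL FL).
move=> u /cmeasurableP[mu1 mu2] /isL2_sqint[u1 u2].
have iE1 := sqintM_integrable (sqintB q1 EL) u1.
have iE2 := sqintM_integrable (sqintB q1 EL) u2.
have iF1 := sqintM_integrable (sqintB q2 FL) u1.
have iF2 := sqintM_integrable (sqintB q2 FL) u2.
rewrite /cintegral -[RHS]/((0 +i* 0)%C); congr (_ +i* _)%C.
  rewrite -[RHS](addr0 0) -[X in X + _](EP _ mu1 u1) -[X in _ + X](FP _ mu2 u2).
  rewrite -RintegralD//; apply: eq_Rintegral => x _.
  by case: (q x) (u (phi x)) => [a b] [a' b'] /=; ring.
rewrite -[RHS](subr0 0) -[X in X - _](FP _ mu1 u1) -[X in _ - X](EP _ mu2 u2).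
rewrite -RintegralB//; apply: eq_Rintegral => x _.
by case: (q x) (u (phi x)) => [a b] [a' b'] /=; ring.
Qed.

End complex_projection.

(** * The weighted measure and the topology of L2 *)

Section L2_topology.
Context d (X : measurableType d) (R : realType) (mu : {measure set X -> \bar R}).

Lemma L2_dot_norm (f : L2 mu) : L2_dot f f = `|f| ^+ 2.
Proof. by rewrite L2_normE sqrtCK. Qed.

Lemma isL2_integral_fin_num (q : X -> R[i]) : isL2 mu q ->
  (\int[mu]_x (normc (q x) ^+ 2)%:E \is a fin_num)%E.
Proof.
by move=> [_ qi]; rewrite ge0_fin_numE// integral_ge0// => x _; rewrite lee_fin sqr_ge0.
Qed.

Lemma L2_norm_lt (f : L2 mu) (e : R) : 0 < e ->
  (`|f| < e%:C%C) = (\int[mu]_x (normc (f x) ^+ 2)%:E < (e ^+ 2)%:E)%E.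
Proof.
move=> e0; have e0C : 0 < e%:C%C :> R[i] by rewrite ltcR.
rewrite -(@ltr_pXn2r _ 2)// ?nnegrE// ?(ltW e0C)// -L2_dot_norm L2_dotxx.
rewrite -(rmorphXn (@real_complex R)) ltcR /Rintegral.
by rewrite -lte_fin fineK// isL2_integral_fin_num//; exact: L2_reprP.
Qed.

Lemma ae_eq_integral_sqr_normc (q r : X -> R[i]) : measurable_fun setT q ->
  measurable_fun setT r -> {ae mu, forall x, q x = r x} ->
  (\int[mu]_x (normc (q x) ^+ 2)%:E = \int[mu]_x (normc (r x) ^+ 2)%:E)%E.
Proof.
move=> mq mr qr; apply: ae_eq_integral => //.
- exact/measurable_EFinP/measurable_sqr_normc.
- exact/measurable_EFinP/measurable_sqr_normc.
- by apply: filterS qr => x ->.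
Qed.

Lemma L2B_ae (f g : L2 mu) : {ae mu, forall x, (f - g : L2 mu) x = f x - g x}.
Proof.
have := L2D_ae f (- g); have := L2Z_ae (-1) g; rewrite scaleN1r.
by apply: filterS2 => x -> ->; rewrite mulN1r.
Qed.

(** Density in the normed topology of L2, restated with integrals of
representatives and a real radius; the radius of a ball in L2 is a complex
number. *)
Lemma L2_denseP (A : set (L2 mu)) : dense A <->
  forall (f : L2 mu) (e : R), 0 < e -> exists2 v : L2 mu, A v &
    (\int[mu]_x (normc (f x - v x) ^+ 2)%:E < e%:E)%E.
Proof.
have normB (f v : L2 mu) : (\int[mu]_x (normc (f x - v x) ^+ 2)%:E =
    \int[mu]_x (normc ((f - v : L2 mu) x) ^+ 2)%:E)%E.
  apply: ae_eq_integral_sqr_normc.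
  - apply: (isL2B (L2_reprP f) (L2_reprP v)).1.
  - by case: (L2_reprP (f - v)).
  - by apply: filterS (L2B_ae f v) => x ->.
split=> [dA f e e0|dA O [f Of] oO].
  have s0 : 0 < Num.sqrt e by rewrite sqrtr_gt0.
  have s0C : 0 < (Num.sqrt e)%:C%C :> R[i] by rewrite ltcR.
  have [v [fv Av]] := dA (ball f (Num.sqrt e)%:C%C)
    (ex_intro _ f (ballxx f s0C)) (ball_open f _).
  exists v => //; rewrite normB -(sqr_sqrtr (ltW e0)) -L2_norm_lt//.
have /nbhs_ballP[e /= e0 fO] : nbhs f O by exact: open_nbhs_nbhs.
have eE : e = (complex.Re e)%:C%C by rewrite RRe_real// gtr0_real.
have Re0 : 0 < complex.Re e by rewrite -ltcR -eE.
have [v Av fv] := dA f _ (exprn_gt0 2 Re0).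
exists v; split => //; apply: fO; rewrite -ball_normE /= eE L2_norm_lt//.
by rewrite -normB.
Qed.

End L2_topology.

Section weighted_measure.
Context d (X : measurableType d) (R : realType) (mu : {measure set X -> \bar R}).
Variables (phi : {mfun X >-> X}) (w : {mfun X >-> R[i]}).
Local Notation m := (wmeasure mu w).

Lemma measurable_sqr_normc_w : measurable_fun setT (fun x => normc (w x) ^+ 2).
Proof. exact: measurable_sqr_normc. Qed.

Lemma integral_wmeasure (f : X -> R) : measurable_fun setT f ->
  (\int[m]_x (f x)%:E = \int[mu]_x (f x * normc (w x) ^+ 2)%:E)%E.
Proof.
move=> mf; apply: integral_density => //; first exact: measurable_sqr_normc_w.
by move=> x; exact: sqr_ge0.
Qed.

Lemma cintegral_wmeasure (q : X -> R[i]) : measurable_fun setT q ->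
  cintegral m setT q = cintegral mu setT (fun x => q x * (normc (w x) ^+ 2)%:C%C).
Proof.
move=> /cmeasurableP[q1 q2]; rewrite /cintegral /Rintegral !integral_wmeasure//.
congr (fine _ +i* fine _)%C; apply: eq_integral => x _; congr (_%:E);
  case: (q x) => a b /=; ring.
Qed.

Lemma isL2_wco_fun (f : X -> R[i]) : measurable_fun setT f ->
  isL2 mu (wco_fun phi w f) <-> isL2 m (f \o phi).
Proof.
move=> mf; have mfphi : measurable_fun setT (f \o phi) by exact: measurableT_comp.
have mwf := measurable_wco_fun phi w mf.
rewrite /isL2 integral_wmeasure; last exact: measurable_sqr_normc.
under [X in (_ /\ X < _)%E <-> _]eq_integral do
  rewrite /wco_fun normcM exprMn mulrC.
by split=> -[].
Qed.

Lemma measurable_wdiv (f : X -> R[i]) : measurable_fun setT f ->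
  measurable_fun setT (wdiv w f).
Proof.
move=> mf.
have -> : wdiv w f = (fun x => f x * (w x)^-1).
  apply/funext => x; rewrite /wdiv; have [->|//] := eqVneq (w x) 0.
  by rewrite invr0 mulr0.
apply: cmeasurableM => //.
have /cmeasurableP[m1 m2] : measurable_fun setT w by [].
have mV : measurable_fun setT (fun x => (normc (w x) ^+ 2)^-1).
  rewrite (_ : (fun x => _) = (fun x => (normc (w x) ^+ 2) `^ (-1))).
    apply: (measurableT_comp (measurable_powR (-1))); exact: measurable_sqr_normc_w.
  by apply/funext => x; rewrite powR_inv1// sqr_ge0.
apply/cmeasurableP; split.
  rewrite (_ : (fun x => _) = (fun x => complex.Re (w x) * (normc (w x) ^+ 2)^-1)).
    exact: measurable_funM.
  by apply/funext => x; rewrite sqr_normc_reim; case: (w x).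
rewrite (_ : (fun x => _) = (fun x => - (complex.Im (w x) * (normc (w x) ^+ 2)^-1))).
  by apply: measurableT_comp => //; exact: measurable_funM.
by apply/funext => x; rewrite sqr_normc_reim; case: (w x).
Qed.

Lemma isL2_wdiv (f : X -> R[i]) : isL2 mu f -> isL2 m (wdiv w f).
Proof.
move=> [mf fi]; split; first exact: measurable_wdiv.
rewrite integral_wmeasure; last exact/measurable_sqr_normc/measurable_wdiv.
apply: le_lt_trans fi; apply: ge0_le_integral => //.
- by move=> x _; rewrite lee_fin mulr_ge0 ?sqr_ge0.
- apply/measurable_EFinP; apply: measurable_funM.
    exact/measurable_sqr_normc/measurable_wdiv.
  exact: measurable_sqr_normc_w.
- exact/measurable_EFinP/measurable_sqr_normc.
move=> x _; rewrite lee_fin /wdiv; have [|w0] := eqVneq (w x) 0.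
  by rewrite normc0 expr0n/= mul0r sqr_ge0.
by rewrite -exprMn -normcM divfK.
Qed.

(** The identity behind the change of measure: [|w|^2] times the left
integrand is the right one. Where [w = 0], both of them vanish, whatever the
value given to [f / w] there. *)
Lemma cintegral_wdiv_conj (f u v : X -> R[i]) : measurable_fun setT f ->
  measurable_fun setT u -> measurable_fun setT v ->
  cintegral m setT (fun x => (wdiv w f x - v (phi x)) * Num.conj (u (phi x))) =
  cintegral mu setT
    (fun x => (f x - wco_fun phi w v x) * Num.conj (wco_fun phi w u x)).
Proof.
move=> mf mu' mv; rewrite cintegral_wmeasure; last first.
  apply: cmeasurableM; last first.
    by apply: (@cmeasurable_conj _ _ _ (u \o phi)); exact: measurableT_comp.
  have mvphi : measurable_fun setT (v \o phi) by exact: measurableT_comp.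
  have m1 : measurable_fun setT (fun _ : X => -1 : R[i]) by exact: measurable_cst.
  have := cmeasurableD (measurable_wdiv mf) (cmeasurableM m1 mvphi).
  by congr measurable_fun; apply/funext => x; rewrite !fctE mulN1r.
congr cintegral; apply/funext => x.
have -> : (normc (w x) ^+ 2)%:C%C = w x * Num.conj (w x).
  case: (w x) => a b; rewrite sqr_normc_reim /=; congr (_ +i* _)%C => /=; ring.
rewrite /wdiv /wco_fun; have [->|w0] := eqVneq (w x) 0.
  by rewrite !(conjC0, mul0r, mulr0).
rewrite (rmorphM Num.conj)/=.
by move: (Num.conj (w x)) (Num.conj (u (phi x))) => a b; field.
Qed.

End weighted_measure.

(** * Finite exhaustion from a dense domain *)

Section exhaustion.
Context d (X : measurableType d) (R : realType).
Variables (mu : {sigma_finite_measure set X -> \bar R}).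
Variables (phi : {mfun X >-> X}) (w : {mfun X >-> R[i]}).
Hypothesis wd : wco_well_defined mu phi w.
Hypothesis dd : densely_defined (wco wd).
Local Notation m := (wmeasure mu w).
Local Notation nu := (pushforward m phi).

Lemma sqr_dist1_ge (a b : R) : a ^+ 2 + b ^+ 2 < 1 / 4 ->
  1 / 4 <= (1 - a) ^+ 2 + b ^+ 2.
Proof.
rewrite !expr2 => ab; have [a2|a2] := leP (1 / 2) a; last by nra.
suff : 1 / 4 <= a * a + b * b by rewrite leNgt ab.
by have := sqr_ge0 b; rewrite expr2; nra.
Qed.

Lemma markov_sqr d' (T : measurableType d') (m' : {measure set T -> \bar R})
    (q : T -> R[i]) (A : set T) : measurable A -> measurable_fun setT q ->
  (forall x, A x -> 1 / 4 <= normc (q x) ^+ 2) ->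
  (m' A <= 4%:E * \int[m']_x (normc (q x) ^+ 2)%:E)%E.
Proof.
move=> mA mq Aq.
have mq2 : measurable_fun setT (fun x => (normc (q x) ^+ 2)%:E).
  exact/measurable_EFinP/measurable_sqr_normc.
have q0 x : setT x -> (0 <= (normc (q x) ^+ 2)%:E)%E by rewrite lee_fin sqr_ge0.
rewrite -ge0_integralZl//.
have -> : m' A = (\int[m']_x (\1_A x)%:E)%E by rewrite integral_indic// setIT.
apply: ge0_le_integral => //.
- by apply/measurable_EFinP; exact: measurable_indic.
- exact: measurable_funeM.
move=> x _; rewrite -EFinM lee_fin indicE.
have [/set_mem/Aq|_] := boolP (x \in A); first by rewrite /=; lra.
by rewrite mulr_ge0// sqr_ge0.
Qed.

(** Let [G n] increase to the space with [mu (G n)] finite. The domain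
is dense, so it contains [f n] close to the indicator of [G n]. On the part
[B n] of [G n] where [|f n| >= 1/2], Markov's inequality for [f n] in L2([nu])
bounds [nu (B n)]; on the rest of [G n], [f n] is far from 1, so that this rest
has a small [mu]-measure. Hence the [B n] exhaust the space up to a [mu]-null
set, which is [nu]-null by absolute continuity. *)
Lemma wco_exhaustion : exists E : (set X)^nat,
  [/\ setT = \bigcup_n E n, nondecreasing_seq E,
      forall n, measurable (E n), forall n, (mu (E n) < +oo)%E &
      forall n, (nu (E n) < +oo)%E].
Proof.
have [G [GT ndG /all_and2[mG muG]]] := (sigma_finiteP _ _).1 (sigma_finiteT mu).
have : forall n, exists f : L2 mu, dom (wco wd) f /\
    (\int[mu]_x (normc ((\1_(G n) x)%:C%C - f x) ^+ 2)%:E < (n.+1%:R^-1)%:E)%E.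
  move=> n; have GL := isL2_indic (mG n) (muG n).
  have := (L2_denseP _).1 dd (L2_of mu (fun x => (\1_(G n) x)%:C%C)) n.+1%:R^-1.
  rewrite invr_gt0 ltr0n => /(_ isT)[f Df fG]; exists f; split => //.
  have mf : measurable_fun setT f by case: (L2_reprP f).
  apply: le_lt_trans fG; rewrite le_eqVlt; apply/orP; left; apply/eqP.
  apply: ae_eq_integral_sqr_normc.
  - exact: (isL2B GL (L2_reprP f)).1.
  - exact: (isL2B (L2_reprP _) (L2_reprP f)).1.
  - by apply: filterS (L2_of_ae GL) => x ->.
move=> /choice[f /all_and2[Df fG]].
have mf n : measurable_fun setT (f n) by case: (L2_reprP (f n)).
pose B n := G n `&` [set x | 1 / 4 <= normc (f n x) ^+ 2].
have mB n : measurable (B n).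
  apply: measurableI => //.
  have m4 : measurable_fun [set: X] (fun=> 1 / 4 : R) by exact: measurable_cst.
  have := measurable_fun_le measurableT m4 (measurable_sqr_normc (mf n)).
  by rewrite setTI.
have nuB n : (nu (B n) < +oo)%E.
  have fL := (isL2_wco_fun mu phi w (mf n)).1 (Df n).
  have mphiB : measurable (phi @^-1` B n) by exact: measurable_funPTI.
  have := markov_sqr m mphiB fL.1 (fun x Bx => Bx.2).
  move/le_lt_trans; apply.
  by rewrite lte_mul_pinfty ?lee_fin//; case: fL.
(* on this set [|1 - f n| >= 1/2], while its squared integral is below 1/(n+1) *)
have muGB n : (mu (G n `\` B n) <= (4 / n.+1%:R)%:E)%E.
  have mGf : measurable_fun setT (fun x => (\1_(G n) x)%:C%C - f n x).
    exact: (isL2B (isL2_indic (mG n) (muG n)) (L2_reprP (f n))).1.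
  have mGB : measurable (G n `\` B n) by exact: measurableD.
  apply: le_trans (markov_sqr mu mGB mGf _) _.
    move=> x [Gx nBx]; have /negP : ~ (1 / 4 <= normc (f n x) ^+ 2).
      by move=> fx; apply: nBx.
    rewrite -ltNge indicE mem_set//; case: (f n x) => a b.
    by rewrite !sqr_normc_reim/= sub0r sqrrN; exact: sqr_dist1_ge.
  by rewrite EFinM lee_pmul2l// ltW.
pose N := ~` \bigcup_n B n.
have mN : measurable N by apply: measurableC; exact: bigcup_measurable.
have muN : mu N = 0%E.
  have NE : N = \bigcup_n (N `&` G n) by rewrite -setI_bigcupr -GT setIT.
  have muNG j : mu (N `&` G j) = 0%E.
    apply/eqP; rewrite -measure_le0; apply/lee_addgt0Pr => e e0.
    have e4 : 0 < e / 4 by rewrite divr_gt0.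
    rewrite add0e; near \oo => n.
    apply: (@le_trans _ _ (4 / n.+1%:R)%:E); last first.
      rewrite lee_fin -ler_pdivlMl// mulrC ltW//; near: n.
      exact: (near_infty_natSinv_lt (PosNum e4)).
    apply: le_trans (muGB n); rewrite le_measure ?inE//.
    - exact: measurableI.
    - exact: measurableD.
    move=> x [Nx Gx]; split; last by move=> Bx; apply: Nx; exists n.
    have jn : (j <= n)%N by near: n; exists j.
    by have /subsetPset := ndG j n jn; exact.
  apply/(negligibleP _ mN); rewrite NE; apply: negligible_bigcup => j.
  by apply/negligibleP; [exact: measurableI|exact: muNG].
have nuN : nu N = 0%E.
  by have /null_content_dominatesP := wd; exact.
have mBn n : measurable (\bigcup_(i in `I_n.+1) B i).
  by apply: bigcup_measurable => i _.
exists (fun n => (\bigcup_(i in `I_n.+1) B i) `|` (N `&` G n)); split.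
- apply/esym; rewrite -subTset => x _.
  have [[i _ Bi]|Nx] := pselect ((\bigcup_n B n) x).
    by exists i => //; left; exists i => //=.
  have [j _ Gj] : (\bigcup_j G j) x by rewrite -GT.
  by exists j => //; right.
- move=> i j ij; apply/subsetPset; apply: setUSS.
    by apply: bigcup_subset => k /= ki; exact: leq_trans ki _.
  by apply: setIS; apply/subsetPset/ndG.
- by move=> n; apply: measurableU => //; exact: measurableI.
- move=> n; apply: le_lt_trans (muG n); rewrite le_measure ?inE//.
    by apply: measurableU => //; exact: measurableI.
  move=> x [[i /= ni [Gi _]]|[]//].
  by have /subsetPset := ndG i n ni; exact.
- move=> n; apply: le_lt_trans (measureU2 _ _ _) _ => //.
    exact: measurableI.
  rewrite lte_add_pinfty//.
    rewrite bigcup_mkord; apply: le_lt_trans (Boole_inequality _ _) _ => //.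
    by apply: lte_sum_pinfty => i _; exact: nuB.
  apply: (@le_lt_trans _ _ (nu N)); last by rewrite nuN.
  by apply: le_measure; rewrite ?inE//; exact: measurableI.
Unshelve. all: by end_near. Qed.

End exhaustion.

(** * Conditional expectation *)

Section preimage_conditioning.
Context d d' (X : measurableType d) (Y : measurableType d') (R : realType).
Variables (m : {measure set X -> \bar R}) (phi : {mfun X >-> Y}).
Local Notation nu := (pushforward m phi).
Hypothesis sfnu : sigma_finite setT nu.

(** The set where [r >= 0] is a preimage under [phi]. On its
intersection with a preimage of finite measure, the integral of [|r|] is the
integral of [r], that is, 0; the same holds for the complement, up to sign. *)
Lemma preimage_measurable_eq0 (r : X -> R) :
  measurable_fun [set: g_sigma_algebra_preimageType phi] r ->
  (forall A, measurable A -> (nu A < +oo)%E ->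
    m.-integrable (phi @^-1` A) (EFin \o r) /\
    (\int[m]_(x in phi @^-1` A) r x = 0)%R) ->
  {ae m, forall x, r x = 0}.
Proof.
move=> mr r0.
have [B mB Br] := mr measurableT `[0, +oo[%classic (measurable_itv _).
rewrite !setTI in Br.
have BE x : B (phi x) = (0 <= r x) :> Prop.
  by rewrite -[LHS]/((phi @^-1` B) x) Br /= in_itv/= andbT.
have mpre A : measurable A -> measurable (phi @^-1` A).
  by move=> mA; exact: measurable_funPTI.
have [F FT /all_and2[mF nuF]] := sfnu.
have nuFI k A : measurable A -> (nu (F k `&` A) < +oo)%E.
  move=> mA; apply: le_lt_trans (nuF k); apply: le_measure; rewrite ?inE//.
  exact: measurableI.
have ae0 A s : measurable A -> (nu A < +oo)%E ->
    (forall x, A (phi x) -> `|r x| = (-1) ^+ nat_of_bool s * r x) ->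
    {ae m, forall x, A (phi x) -> r x = 0}.
  move=> mA nuA rs; have [ri rA] := r0 _ mA nuA.
  have : (\int[m]_(x in phi @^-1` A) `|(r x)%:E| = 0)%E.
    have -> : (\int[m]_(x in phi @^-1` A) `|(r x)%:E| =
        \int[m]_(x in phi @^-1` A) (((-1) ^+ nat_of_bool s)%:E * (r x)%:E))%E.
      by apply: eq_integral => x /[!inE] Ax; rewrite abse_EFin rs// EFinM.
    rewrite integralZl//; last exact: mpre.
    rewrite -[X in (_ * X)%E]fineK; last by apply: integrable_fin_num => //; exact: mpre.
    by rewrite -/(Rintegral _ _ _) rA mule0.
  move/(ae_eq_integral_abs m (mpre _ mA) (measurable_int _ ri)).
  by apply: filterS => x rx Ax; have [] := rx Ax.
have : {ae m, forall x k, F k (phi x) -> r x = 0}.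
  apply/ae_foralln => k.
  have mFB := measurableI _ _ (mF k) mB.
  have mFC := measurableI _ _ (mF k) (measurableC mB).
  have := ae0 _ false mFB (nuFI _ _ mB).
  have := ae0 _ true mFC (nuFI _ _ (measurableC mB)).
  rewrite expr0 expr1 => hC hB.
  have {}hB : {ae m, forall x, (F k `&` B) (phi x) -> r x = 0}.
    by apply: hB => x [_]; rewrite BE mul1r => /ger0_norm.
  have {}hC : {ae m, forall x, (F k `&` ~` B) (phi x) -> r x = 0}.
    apply: hC => x [_] /=; rewrite BE mulN1r => /negP.
    by rewrite -ltNge => /ltr0_norm.
  move: hB hC; apply: filterS2 => x hB hC Fk.
  by have [Bx|Bx] := pselect (B (phi x)); [exact: hB|exact: hC].
apply: filterS => x hx; have : (\bigcup_k F k) (phi x) by rewrite -FT.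
by case=> k _; exact: hx.
Qed.

End preimage_conditioning.

Section conditional_expectation.
Context d (X : measurableType d) (R : realType).
Variables (mu : {measure set X -> \bar R}).
Variables (phi : {mfun X >-> X}) (w : {mfun X >-> R[i]}).
Local Notation m := (wmeasure mu w).
Local Notation nu := (pushforward m phi).
Hypothesis sfnu : sigma_finite setT nu.

Lemma isL2_indic_phi (A : set X) : measurable A -> (nu A < +oo)%E ->
  isL2 m ((fun y => (\1_A y)%:C%C : R[i]) \o phi).
Proof.
move=> mA nuA; have mphiA : measurable (phi @^-1` A) by exact: measurable_funPTI.
exact: (@isL2_indic _ _ _ m _ mphiA nuA).
Qed.

Lemma cintegral_mul_indic (A : set X) (e : X -> R[i]) : measurable A ->
  cintegral m (phi @^-1` A) e =
  cintegral m setT (fun x => e x * Num.conj ((\1_A (phi x))%:C%C)).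
Proof.
move=> mA; rewrite /cintegral.
have EA x : (x \in phi @^-1` A) = (phi x \in A) by apply/idP/idP; rewrite !inE.
congr (_ +i* _)%C; rewrite Rintegral_mkcond; apply: eq_Rintegral => x _;
  rewrite patchE EA indicE; case: (e x) => a b; case: (_ \in _) => /=;
  rewrite -?[point]/(0 : R); ring.
Qed.

Lemma cintegrable_mul_indic (A : set X) (e : X -> R[i]) : measurable A ->
  cintegrable m setT (fun x => e x * Num.conj ((\1_A (phi x))%:C%C)) ->
  cintegrable m (phi @^-1` A) e.
Proof.
move=> mA; have mphiA : measurable (phi @^-1` A) by exact: measurable_funPTI.
move=> [i1 i2]; split.
  have := integrableS measurableT mphiA (@subsetT _ _) i1.
  apply: eq_integrable => // x /[!inE] Ax; congr (_%:E).
  by rewrite indicE mem_set//; case: (e x) => a b /=; ring.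
have := integrableS measurableT mphiA (@subsetT _ _) i2.
apply: eq_integrable => // x /[!inE] Ax; congr (_%:E).
by rewrite indicE mem_set//; case: (e x) => a b /=; ring.
Qed.

Lemma is_wco_condexp_unique (q e g : X -> R[i]) :
  is_wco_condexp mu phi w q e -> is_wco_condexp mu phi w q g ->
  {ae m, forall x, e x = g x}.
Proof.
move=> [/cmeasurableP[me1 me2] eP] [/cmeasurableP[mg1 mg2] gP].
have re0 : {ae m, forall x, complex.Re (e x) - complex.Re (g x) = 0}.
  apply: (preimage_measurable_eq0 sfnu); first exact: measurable_funB.
  move=> A mA nuA; have [[ei1 ei2] ee] := eP A mA nuA.
  have [[gi1 gi2] ge] := gP A mA nuA.
  have mphiA : measurable (phi @^-1` A) by exact: measurable_funPTI.
  split; first by have := integrableB mphiA ei1 gi1; apply: eq_integrable.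
  rewrite RintegralB//; apply/eqP; rewrite subr_eq0; apply/eqP.
  by have := congr1 (@complex.Re R) (etrans ee (esym ge)).
have im0 : {ae m, forall x, complex.Im (e x) - complex.Im (g x) = 0}.
  apply: (preimage_measurable_eq0 sfnu); first exact: measurable_funB.
  move=> A mA nuA; have [[ei1 ei2] ee] := eP A mA nuA.
  have [[gi1 gi2] ge] := gP A mA nuA.
  have mphiA : measurable (phi @^-1` A) by exact: measurable_funPTI.
  split; first by have := integrableB mphiA ei2 gi2; apply: eq_integrable.
  rewrite RintegralB//; apply/eqP; rewrite subr_eq0; apply/eqP.
  by have := congr1 (@complex.Im R) (etrans ee (esym ge)).
move: re0 im0; apply: filterS2 => x.
case: (e x) (g x) => [a b] [a' b'] /= /eqP; rewrite subr_eq0 => /eqP ->.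
by move=> /eqP; rewrite subr_eq0 => /eqP ->.
Qed.

(** Orthogonality to the indicator of [A], composed with [phi], is
the averaging property over [phi^-1 (A)]. *)
Lemma projection_is_wco_condexp (q g : X -> R[i]) : isL2 m q ->
  measurable_fun setT g -> isL2 m (g \o phi) ->
  (forall u : X -> R[i], measurable_fun setT u -> isL2 m (u \o phi) ->
     cintegral m setT (fun x => (q x - g (phi x)) * Num.conj (u (phi x))) = 0) ->
  is_wco_condexp mu phi w q (g \o phi).
Proof.
move=> qL mg gL gP; split.
  move=> _ B mB; exists (g @^-1` B) => //.
  by rewrite -[X in measurable X]setTI; exact: mg.
move=> A mA nuA.
have AL := isL2_indic_phi mA nuA.
have mA' : measurable_fun setT (fun y => (\1_A y)%:C%C : R[i]).
  by apply/cmeasurableP; split => //=; exact: measurable_indic.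
have igA := isL2_mul_conj gL AL.
have iqA := isL2_mul_conj qL AL.
split; first exact: cintegrable_mul_indic.
rewrite !cintegral_mul_indic//.
have iqgA := isL2_mul_conj (isL2B qL gL) AL.
have -> : cintegral m setT (fun x => q x * Num.conj (\1_A (phi x))%:C%C) =
   cintegral m setT (fun x => (q x - g (phi x)) * Num.conj (\1_A (phi x))%:C%C +
      g (phi x) * Num.conj (\1_A (phi x))%:C%C).
  by congr cintegral; apply/funext => x; rewrite -mulrDl subrK.
by rewrite cintegralD// (gP _ mA' AL) add0r.
Qed.

Lemma wco_condexp_projection (q : X -> R[i]) : isL2 m q -> exists g : X -> R[i],
  [/\ measurable_fun setT g, isL2 m (g \o phi),
   forall u : X -> R[i], measurable_fun setT u -> isL2 m (u \o phi) ->
     cintegral m setT (fun x => (q x - g (phi x)) * Num.conj (u (phi x))) = 0 &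
   {ae m, forall x, wco_condexp mu phi w q x = g (phi x)}].
Proof.
move=> qL; have [g [mg gL gP]] := ex_complex_projection sfnu qL.
exists g; split => //.
have gC := projection_is_wco_condexp qL mg gL gP.
apply: is_wco_condexp_unique (gC).
exact: (@xgetI _ _ [set e | is_wco_condexp mu phi w q e] _ gC).
Qed.

End conditional_expectation.

(** * Null sets of the weighted measure and of its push-forward *)

Section null_sets.
Context d (X : measurableType d) (R : realType).

Lemma density_null (mu nu : {measure set X -> \bar R}) (h : X -> \bar R) (A : set X) :
  measurable_fun setT h -> (forall x, (0 <= h x)%E) -> measurable A ->
  nu A = (\int[mu]_(x in A) h x)%E ->
  nu A = 0%E <-> {ae mu, forall x, A x -> h x = 0%E}.
Proof.
move=> mh h0 mA ->.
have -> : (\int[mu]_(x in A) h x = \int[mu]_(x in A) `|h x|)%E.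
  by apply: eq_integral => x _; rewrite gee0_abs.
exact: (ae_eq_integral_abs mu mA (measurable_funTS mh)).
Qed.

Lemma measurable_neq (u v : X -> R[i]) : measurable_fun setT u ->
  measurable_fun setT v -> measurable [set x | u x <> v x].
Proof.
move=> /cmeasurableP[u1 u2] /cmeasurableP[v1 v2].
pose s x := (complex.Re (u x) - complex.Re (v x)) ^+ 2 +
  (complex.Im (u x) - complex.Im (v x)) ^+ 2.
have ms : measurable_fun setT (EFin \o s).
  apply/measurable_EFinP; apply: measurable_funD;
    apply: measurable_funX; exact: measurable_funB.
have := emeasurable_neq measurableT ms 0%E; rewrite setTI.
congr measurable; apply/seteqP; split => x /=; rewrite eqe /s.
  by move=> + uv; rewrite uv !subrr !expr0n/= addr0 eqxx.
move=> uv; apply/negP; rewrite paddr_eq0 ?sqr_ge0// !sqrf_eq0 !subr_eq0.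
by move=> /andP[/eqP ab /eqP cd]; apply: uv; apply/eqP; rewrite eq_complex ab cd !eqxx.
Qed.

Lemma ae_eq_null (m : {measure set X -> \bar R}) (u v : X -> R[i]) :
  measurable_fun setT u -> measurable_fun setT v ->
  {ae m, forall x, u x = v x} <-> m [set x | u x <> v x] = 0%E.
Proof. by move=> mu mv; apply: negligibleP; exact: measurable_neq. Qed.

End null_sets.

Section weighted_null_sets.
Context d (X : measurableType d) (R : realType).
Variables (mu : {sigma_finite_measure set X -> \bar R}).
Variables (phi : {mfun X >-> X}) (w : {mfun X >-> R[i]}).
Hypothesis wd : wco_well_defined mu phi w.
Local Notation m := (wmeasure mu w).
Local Notation nu := (pushforward m phi).
Hypothesis sfnu : sigma_finite setT nu.
Local Notation h := (wco_rnderiv mu phi w).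

Lemma wco_rnderivP : [/\ measurable_fun setT h, forall x, (0 <= h x)%E &
  forall A, measurable A -> nu A = (\int[mu]_(x in A) h x)%E].
Proof.
have [g [mg g0 gE]] := sigma_finite_radon_nikodym (sigma_finiteT mu) sfnu wd.
pose S := [set h : X -> \bar R | [/\ measurable_fun setT h, forall x, (0 <= h x)%E &
      forall A, measurable A -> nu A = (\int[mu]_(x in A) h x)%E]].
have Sg : S (EFin \o g).
  by split => //; exact/measurable_EFinP.
exact: (@xgetI _ _ S _ Sg).
Qed.

(** The set where [u] and [v] differ is [nu]-null exactly when [h]
vanishes almost everywhere on it. *)
Lemma wco_comp_ae_eq (u v : X -> R[i]) : measurable_fun setT u ->
  measurable_fun setT v ->
  {ae m, forall x, u (phi x) = v (phi x)} <->
  {ae mu, forall x, h x <> 0%E -> u x = v x}.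
Proof.
move=> mu' mv; have [mh h0 hE] := wco_rnderivP.
have mA := measurable_neq mu' mv.
have muphi : measurable_fun setT (u \o phi) by exact: measurableT_comp.
have mvphi : measurable_fun setT (v \o phi) by exact: measurableT_comp.
have nuA := density_null mh h0 mA (hE _ mA).
have {}nuA := nuA (measurable_funPT phi).
have muv := ae_eq_null m muphi mvphi.
split => [uv|huv].
  move: (nuA.1 (muv.1 uv)).
  by apply: filterS => x /= uvh hx; apply: contrapT => /uvh.
apply: (muv.2); apply: (nuA.2); apply: filterS huv => x /= huv uv.
by apply: contrapT => /huv.
Qed.

Lemma wco_fun_ae_eq0 (u : X -> R[i]) : measurable_fun setT u ->
  {ae mu, forall x, wco_fun phi w u x = 0} <->
  {ae m, forall x, u (phi x) = 0}.
Proof.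
move=> mu'; have m0 : measurable_fun setT (cst 0 : X -> R[i]) by exact: measurable_cst.
have muphi : measurable_fun setT (u \o phi) by exact: measurableT_comp.
have mA := measurable_neq muphi m0.
have w0 x : (0 <= (normc (w x) ^+ 2)%:E)%E by rewrite lee_fin sqr_ge0.
have u0 := ae_eq_null m muphi m0.
have wA := @density_null _ _ _ mu m _ _ (measurable_wmeasure_density w) w0 mA erefl.
split=> [wu0|uphi0].
  apply: u0.2; apply: wA.2; apply: filterS wu0 => x /= /eqP.
  by rewrite mulf_eq0 => /orP[/eqP ->|/eqP //]; rewrite normc0 expr0n.
apply: filterS (wA.1 (u0.1 uphi0)) => x /= wx.
rewrite /wco_fun; have [->|/eqP ux] := eqVneq (u (phi x)) 0; first by rewrite mulr0.
have [/eqP] := wx ux; rewrite sqrf_eq0 => /eqP /eq0_normc.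
by move=> ->; rewrite mul0r.
Qed.

(** Existence is what matters here, as the pullback is defined by
choice: [g] becomes admissible once it is set to 0 where [h = 0], which does
not change [g o phi] up to a null set. *)
Lemma wco_pullbackP (e g : X -> R[i]) : measurable_fun setT g ->
  {ae m, forall x, e x = g (phi x)} ->
  [/\ measurable_fun setT (wco_pullback mu phi w e),
      {ae mu, forall x, h x = 0%E -> wco_pullback mu phi w e x = 0} &
      {ae m, forall x, e x = wco_pullback mu phi w e (phi x)}].
Proof.
move=> mg eg; have [mh h0 hE] := wco_rnderivP.
pose S := [set g : X -> R[i] | [/\ measurable_fun setT g,
        {ae mu, forall x, h x = 0%E -> g x = 0%R} &
        {ae m, forall x, e x = g (phi x)}]].
pose g' x := if h x != 0%E then g x else 0.
have mg' : measurable_fun setT g'.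
  apply: measurable_fun_ifT => //; apply: (measurable_fun_bool true).
  have := emeasurable_neq measurableT mh 0%E; congr measurable.
have Sg : S g'.
  split => //; first by apply: aeW => x hx; rewrite /g' hx eqxx.
  have gg' : {ae m, forall x, g (phi x) = g' (phi x)}.
    by apply/wco_comp_ae_eq => //; apply: aeW => x /eqP hx; rewrite /g' hx.
  by move: eg gg'; apply: filterS2 => x ->.
exact: (@xgetI _ _ S _ Sg).
Qed.

End weighted_null_sets.

(** * The reciprocal of a weighted composition operator *)

Section reciprocal_of_wco.
Context d (X : measurableType d) (R : realType).
Variables (mu : {sigma_finite_measure set X -> \bar R}).
Variables (phi : {mfun X >-> X}) (w : {mfun X >-> R[i]}).
Hypothesis wd : wco_well_defined mu phi w.
Hypothesis dd : densely_defined (wco wd).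
Local Notation m := (wmeasure mu w).
Local Notation nu := (pushforward m phi).
Local Notation h := (wco_rnderiv mu phi w).
Local Notation T := (wco wd).

Lemma sigma_finite_pushforward : sigma_finite setT nu.
Proof.
have [E [ET _ mE _ nuE]] := wco_exhaustion dd.
by exists E => // n; split.
Qed.
Let sfnu := sigma_finite_pushforward.

Lemma measurable_L2 (f : L2 mu) : measurable_fun setT f.
Proof. by case: (L2_reprP f). Qed.

Lemma wco_ae (u : L2 mu) : dom T u -> {ae mu, forall x, (T u : L2 mu) x = wco_fun phi w u x}.
Proof. exact: L2_of_ae. Qed.

(** [T k = 0] means that [k o phi] vanishes almost everywhere for the
weighted measure, which by [wco_comp_ae_eq] is a condition on [k] where [h] is
not 0. *)
Lemma wco_kerP (k : L2 mu) : ker T k <-> {ae mu, forall x, h x <> 0%E -> k x = 0}.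
Proof.
have mk := measurable_L2 k.
have m0 : measurable_fun setT (cst 0 : X -> R[i]) by exact: measurable_cst.
have kE := wco_comp_ae_eq wd sfnu mk m0.
have wkE := @wco_fun_ae_eq0 _ _ _ mu phi w _ mk.
split=> [[Tk Tk0]|k0].
  apply: kE.1; apply: wkE.1.
  have := wco_ae Tk; rewrite Tk0; apply: filterS2 (L20_ae mu) => x.
  by move=> -> <-.
have wk0 := wkE.2 (kE.2 k0).
have Tk : dom T k.
  apply: (@isL2_ae_eq _ _ _ _ (cst 0)) wk0 _; first exact: measurable_wco_fun.
  by have := (isL2_submod mu).1; rewrite inE.
split => //; apply/L2P; move: (wco_ae Tk) wk0 (L20_ae mu).
by apply: filterS3 => x -> -> ->.
Qed.

Definition off_support (v : X -> R[i]) x := if h x != 0%E then 0 else v x.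
Definition on_support (v : X -> R[i]) x := if h x != 0%E then v x else 0.

Lemma measurable_support : measurable_fun setT (fun x => h x != 0%E).
Proof.
have [mh _ _] := wco_rnderivP wd sfnu.
apply: (measurable_fun_bool true).
by have := emeasurable_neq measurableT mh 0%E.
Qed.

Lemma isL2_off_support v : isL2 mu v -> isL2 mu (off_support v).
Proof.
move=> vL; apply: isL2_le (vL).
  apply: measurable_fun_ifT; [exact: measurable_support|exact: measurable_cst|].
  by case: vL.
by move=> x; rewrite /off_support; case: ifP => // _; rewrite normc0 normc_ge0.
Qed.

Lemma isL2_on_support v : isL2 mu v -> isL2 mu (on_support v).
Proof.
move=> vL; apply: isL2_le (vL).
  apply: measurable_fun_ifT; [exact: measurable_support| |exact: measurable_cst].
  by case: vL.
by move=> x; rewrite /on_support; case: ifP => // _; rewrite normc0 normc_ge0.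
Qed.

Lemma L2_dot_eq0 (f g : L2 mu) : {ae mu, forall x, f x * Num.conj (g x) = 0} ->
  L2_dot f g = 0.
Proof.
move=> fg0; rewrite -(L2_dotE_ae (u := cst 0)); last 2 first.
- exact: measurable_cst.
- by apply: filterS fg0 => x ->.
by rewrite /cintegral /Rintegral integral0.
Qed.

(** The restriction of [v] to [{h = 0}] lies in the kernel, and its
inner product with [v] is its squared norm. *)
Lemma wco_orth_kerP (v : L2 mu) : orth (@L2_dot d X R mu) (ker T) v <->
  {ae mu, forall x, h x = 0%E -> v x = 0}.
Proof.
split=> [vk|v0 k /wco_kerP k0]; last first.
  apply: L2_dot_eq0; move: v0 k0; apply: filterS2 => x v0 k0.
  have [/v0 ->|/eqP /k0 ->] := eqVneq (h x) 0%E; first by rewrite mul0r.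
  by rewrite conjC0 mulr0.
have offL := isL2_off_support (L2_reprP v).
pose k := L2_of mu (off_support v).
have kE : {ae mu, forall x, k x = off_support v x} := L2_of_ae offL.
have Tk : ker T k.
  by apply/wco_kerP; apply: filterS kE => x -> /eqP hx; rewrite /off_support hx.
have : k = 0.
  apply: (dotxx_eq0 (dot := @L2_dot d X R mu)); rewrite -[RHS](vk _ Tk).
  apply: L2_dotE_ae; first exact: L2_measurable_mul_conj.
  apply: filterS kE => x ->; rewrite /off_support; case: ifP => // _.
  by rewrite conjC0 !mulr0.
move=> k0; move: kE (L20_ae mu); rewrite k0; apply: filterS2 => x -> + hx.
by rewrite /off_support hx eqxx.
Qed.

Lemma wco_dom_split (u : L2 mu) : dom T u ->
  sumset (ker T) (dom T `&` orth (@L2_dot d X R mu) (ker T)) u.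
Proof.
move=> Tu.
have offL := isL2_off_support (L2_reprP u).
have onL := isL2_on_support (L2_reprP u).
have offE := L2_of_ae offL; have onE := L2_of_ae onL.
have Tk : ker T (L2_of mu (off_support u)).
  by apply/wco_kerP; apply: filterS offE => x -> /eqP hx; rewrite /off_support hx.
have uE : u = L2_of mu (off_support u) + L2_of mu (on_support u).
  apply/L2P; move: offE onE (L2D_ae (L2_of mu (off_support u)) (L2_of mu (on_support u))).
  apply: filterS3 => x offE onE ->; rewrite offE onE /off_support /on_support.
  by case: ifP; rewrite ?add0r ?addr0.
exists (L2_of mu (off_support u)) => //; exists (L2_of mu (on_support u)); last by rewrite -uE.
split.
  have -> : L2_of mu (on_support u) = (-1) *: L2_of mu (off_support u) + u.
    by apply: (addrI (L2_of mu (off_support u))); rewrite -uE scaleN1r addNKr.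
  by apply: dom_linear => //; case: Tk.
apply/wco_orth_kerP; apply: filterS onE => x -> hx.
by rewrite /on_support hx eqxx.
Qed.

Lemma wco_dom_decomposition :
  dom T = sumset (ker T) (dom T `&` orth (@L2_dot d X R mu) (ker T)).
Proof.
apply/seteqP; split; first exact: wco_dom_split.
move=> _ [k [Tk _] [v [Tv _] <-]].
by rewrite -(scale1r k); exact: dom_linear.
Qed.

Local Notation Efw := (fun f : L2 mu =>
    wco_pullback mu phi w (wco_condexp mu phi w (wdiv w f))).

(** [w (E(f_w) o phi^-1 o phi)] is square-integrable and is the
orthogonal projection of [f] on the functions [w (u o phi)]. *)
Lemma wco_pullback_condexpP (f : L2 mu) :
  [/\ measurable_fun setT (Efw f),
      {ae mu, forall x, h x = 0%E -> Efw f x = 0},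
      isL2 mu (wco_fun phi w (Efw f)) &
      forall u : X -> R[i], measurable_fun setT u -> isL2 mu (wco_fun phi w u) ->
      cintegral mu setT (fun x => (f x - wco_fun phi w (Efw f) x) *
        Num.conj (wco_fun phi w u x)) = 0].
Proof.
have mf := measurable_L2 f.
have qL : isL2 m (wdiv w f) by apply: isL2_wdiv; exact: L2_reprP.
have [g [mg gL gP eg]] := wco_condexp_projection sfnu qL.
have [mG G0 eG] := wco_pullbackP wd sfnu mg eg.
have Gg : {ae m, forall x, Efw f (phi x) = g (phi x)}.
  by move: eg eG; apply: filterS2 => x -> ->.
have mGphi : measurable_fun setT (fun x => Efw f (phi x)).
  exact: (measurableT_comp mG).
have GL : isL2 m (Efw f \o phi) by exact: isL2_ae_eq Gg gL.
split => //; first exact/isL2_wco_fun.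
move=> u mu' /(isL2_wco_fun _ _ _ mu') uL.
rewrite -cintegral_wdiv_conj// -[RHS](gP u mu' uL).
apply: ae_eq_cintegral.
- have [/measurable_int/measurable_EFinP m1 /measurable_int/measurable_EFinP m2] :=
    isL2_mul_conj (isL2B qL GL) uL.
  by apply/cmeasurableP.
- have [/measurable_int/measurable_EFinP m1 /measurable_int/measurable_EFinP m2] :=
    isL2_mul_conj (isL2B qL gL) uL.
  by apply/cmeasurableP.
- by apply: filterS Gg => x ->.
Qed.

Definition truncate (E : (set X)^nat) (k : X -> R[i]) n x :=
  if (normc (k x) <= n%:R) && (x \in E n) then k x else 0.

Section truncation.
Variable E : (set X)^nat.
Hypotheses (ET : setT = \bigcup_n E n) (ndE : nondecreasing_seq E)
  (mE : forall n, measurable (E n)) (muE : forall n, (mu (E n) < +oo)%E).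
Variables (k : X -> R[i]) (mk : measurable_fun setT k).

Lemma measurable_truncate n : measurable_fun setT (truncate E k n).
Proof.
apply: measurable_fun_ifT => //; apply: measurable_and.
  rewrite (_ : (fun x => _) = (fun x => normc (k x) ^+ 2 <= n%:R ^+ 2)).
    by apply: measurable_fun_ler; [exact: measurable_sqr_normc|exact: measurable_cst].
  by apply/funext => x; rewrite ler_pXn2r ?nnegrE ?normc_ge0.
apply: (measurable_fun_bool true); rewrite setTI preimage_mem_true.
exact: mE.
Qed.

Lemma normc_truncate n x : normc (truncate E k n x) <= normc (k x).
Proof. by rewrite /truncate; case: ifP => // _; rewrite normc0 normc_ge0. Qed.

Lemma isL2_truncate n : isL2 mu (truncate E k n).
Proof.
have EL := isL2_indic (mE n) (muE n).
have nL : isL2 mu (fun x => n%:R%:C%C * (\1_(E n) x)%:C%C + 0).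
  apply: isL2_linear => //.
  by have := (isL2_submod mu).1; rewrite inE.
apply: isL2_le nL; first exact: measurable_truncate.
move=> x; rewrite /truncate addr0 normcM indicE.
case: ifP => [/andP[kn ->]|_]; last by rewrite normc0 mulr_ge0 ?normc_ge0.
rewrite /= !expr0n/= !addr0 !sqrtr_sqr !ger0_norm ?ler0n//.
by rewrite mulr1.
Qed.

Lemma truncate_near x : \forall n \near \oo, truncate E k n x = k x.
Proof.
have [j _ Ej] : (\bigcup_n E n) x by rewrite -ET.
near=> n; rewrite /truncate ifT//; apply/andP; split.
  by near: n; exact: nbhs_infty_ger.
rewrite inE; have jn : (j <= n)%N by near: n; exists j.
by have /subsetPset := ndE jn; exact.
Unshelve. all: by end_near. Qed.

Lemma isL2_wco_truncate n : isL2 mu (wco_fun phi w k) ->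
  isL2 mu (wco_fun phi w (truncate E k n)).
Proof.
apply: isL2_le; first by apply: measurable_wco_fun; exact: measurable_truncate.
by move=> x; rewrite /wco_fun !normcM ler_wpM2l ?normc_ge0// normc_truncate.
Qed.

End truncation.

(** The truncations of [k] are in the domain of [T]. The inner product
of [w (k o phi)] with the image of a truncation is the squared norm of this
image, because a truncation of [k] coincides with [k] or is 0 at each point. *)
Lemma wco_fun_orth_eq0 (k : X -> R[i]) : measurable_fun setT k ->
  isL2 mu (wco_fun phi w k) ->
  (forall u : L2 mu, dom T u ->
    cintegral mu setT (fun x => wco_fun phi w k x * Num.conj (wco_fun phi w u x)) = 0) ->
  {ae m, forall x, k (phi x) = 0}.
Proof.
have [E [ET ndE mE muE _]] := wco_exhaustion dd.
move=> mk wkL k0; pose kn n := truncate E k n.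
have mkn n : measurable_fun setT (kn n) by exact: measurable_truncate.
have knL n : isL2 mu (kn n) by exact: isL2_truncate.
have wknL n : isL2 mu (wco_fun phi w (kn n)) by exact: isL2_wco_truncate.
have kn0 n : {ae m, forall x, kn n (phi x) = 0}.
  apply/(wco_fun_ae_eq0 _ _ _ (mkn n)).
  pose u := L2_of mu (kn n); pose wu := L2_of mu (wco_fun phi w (kn n)).
  have uE : {ae mu, forall x, u x = kn n x} := L2_of_ae (knL n).
  have wuE : {ae mu, forall x, wu x = wco_fun phi w (kn n) x} := L2_of_ae (wknL n).
  have wuE' := wco_fun_ae wd uE.
  have Tu : dom T u.
    apply: isL2_ae_eq wuE' (wknL n); apply: measurable_wco_fun; exact: measurable_L2.
  have wu0 : wu = 0.
    apply: (dotxx_eq0 (dot := @L2_dot d X R mu)); rewrite -[RHS](k0 _ Tu).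
    apply/esym/L2_dotE_ae.
      apply: cmeasurableM; first by case: wkL.
      apply: cmeasurable_conj; apply: measurable_wco_fun; exact: measurable_L2.
    move: wuE wuE'; apply: filterS2 => x -> ->; rewrite /wco_fun /kn /truncate.
    by case: ifP => // _; rewrite !mulr0 conjC0 !mulr0.
  move: wuE (L20_ae mu); rewrite wu0; apply: filterS2 => x.
  by move=> -> ->.
have := ae_foralln kn0; apply: filterS => x knx0.
have [n _] := truncate_near ET ndE k (phi x).
by move=> /(_ n (leqnn n)) <-; exact: knx0.
Qed.

Lemma wco_L2_of (k : X -> R[i]) : isL2 mu k -> isL2 mu (wco_fun phi w k) ->
  dom T (L2_of mu k) /\
  {ae mu, forall x, (T (L2_of mu k) : L2 mu) x = wco_fun phi w k x}.
Proof.
move=> kL wkL; have kE := wco_fun_ae wd (L2_of_ae kL).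
have Tk : dom T (L2_of mu k).
  by apply: isL2_ae_eq kE wkL; apply: measurable_wco_fun; exact: measurable_L2.
by split => //; move: (wco_ae Tk) kE; apply: filterS2 => x -> ->.
Qed.

Lemma wco_orth_ranP (f F : L2 mu) (k : X -> R[i]) : measurable_fun setT k ->
  isL2 mu (wco_fun phi w k) ->
  {ae mu, forall x, F x = f x - wco_fun phi w k x} ->
  orth (@L2_dot d X R mu) (ran T) F <->
  forall u : L2 mu, dom T u ->
    cintegral mu setT (fun x => (f x - wco_fun phi w k x) *
      Num.conj (wco_fun phi w u x)) = 0.
Proof.
move=> mk wkL FE.
have dotE (u : L2 mu) : dom T u -> L2_dot F (T u) =
    cintegral mu setT (fun x => (f x - wco_fun phi w k x) *
      Num.conj (wco_fun phi w u x)).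
  move=> Tu; apply/esym/L2_dotE_ae.
    apply: cmeasurableM; first exact: (isL2B (L2_reprP f) wkL).1.
    apply: cmeasurable_conj; apply: measurable_wco_fun; exact: measurable_L2.
  by move: FE (wco_ae Tu); apply: filterS2 => x -> ->.
split=> [FT u Tu|FT _ [u Tu <-]]; first by rewrite -dotE//; apply: FT; exists u.
exact: (etrans (dotE u Tu) (FT u Tu)).
Qed.

Lemma truncate_approx (E : (set X)^nat) (k : X -> R[i]) (e : R) :
  setT = \bigcup_n E n -> nondecreasing_seq E ->
  (forall n, measurable (E n)) -> measurable_fun setT k ->
  isL2 mu (wco_fun phi w k) -> 0 < e -> exists n,
  (\int[mu]_x (normc (wco_fun phi w k x - wco_fun phi w (truncate E k n) x) ^+ 2)%:E
     < e%:E)%E.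
Proof.
move=> ET ndE mE mk wkL e0.
pose u n x := (normc (wco_fun phi w k x - wco_fun phi w (truncate E k n) x) ^+ 2)%:E.
have mu_ n : measurable_fun setT (u n).
  apply/measurable_EFinP; apply: measurable_sqr_normc.
  apply: (isL2B wkL (isL2_wco_truncate mE mk n wkL)).1.
have [_ kint] := (isL2P _ _).1 wkL.
have u0 x : u n x @[n --> \oo] --> 0%E.
  apply: cvg_near_cst; apply: filterS (truncate_near ET ndE k (phi x)) => n.
  by rewrite /u /wco_fun => ->; rewrite subrr normc0 expr0n.
have uk n x : (`|u n x| <= (normc (wco_fun phi w k x) ^+ 2)%:E)%E.
  rewrite gee0_abs ?lee_fin ?sqr_ge0// /u /wco_fun -mulrBr !normcM.
  rewrite lerXn2r ?nnegrE ?mulr_ge0 ?normc_ge0// ler_wpM2l ?normc_ge0//.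
  rewrite /truncate; case: ifP => _; rewrite ?subr0// subrr normc0.
  exact: normc_ge0.
have [_ _] := @dominated_convergence _ _ _ mu setT measurableT u (cst 0%E) _ mu_
  (measurable_cst 0%E) (aeW _ (fun x _ => u0 x)) kint (aeW _ (fun x n _ => uk n x)).
rewrite integral0 => ucvg; apply: contrapT => /forallNP eu.
have : (e%:E <= 0)%E.
  apply: cvge_ge ucvg; apply: nearW => n.
  by rewrite leNgt; apply/negP; exact: eu.
by rewrite lee_fin leNgt e0.
Qed.

(** [f] is the sum of [f - w (g o phi)], orthogonal to the range, and
of [w (g o phi)], which is approximated by the images of the truncations of
[g]. *)
Lemma wco_ran_dense :
  dense (sumset (ran T) (orth (@L2_dot d X R mu) (ran T))).
Proof.
have [E [ET ndE mE muE _]] := wco_exhaustion dd.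
apply/L2_denseP => f e e0; have [mG _ wGL GP] := wco_pullback_condexpP f.
have [n GE] := truncate_approx ET ndE mE mG wGL e0.
have GnL := isL2_truncate mE muE mG n.
have wGnL := isL2_wco_truncate mE mG n wGL.
have [TGn TGnE] := wco_L2_of GnL wGnL.
pose W := L2_of mu (wco_fun phi w (Efw f)).
have WE : {ae mu, forall x, W x = wco_fun phi w (Efw f) x} := L2_of_ae wGL.
set u := L2_of mu _ in TGn TGnE.
exists (T u + (f - W)).
  exists (T u); first by exists u.
  exists (f - W) => //.
  apply/(wco_orth_ranP mG wGL); last first.
    by move=> v Tv; apply: GP; [exact: measurable_L2|exact: Tv].
  by move: (L2B_ae f W) WE; apply: filterS2 => x -> ->.
apply: le_lt_trans GE; rewrite le_eqVlt; apply/orP; left; apply/eqP.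
apply: ae_eq_integral_sqr_normc.
- exact: (isL2B (L2_reprP f) (L2_reprP _)).1.
- exact: (isL2B wGL wGnL).1.
have vE := L2D_ae (T u) (f - W); have fWE := L2B_ae f W.
near=> x; rewrite (near vE x)// (near fWE x)// (near WE x)// (near TGnE x)//.
by ring.
Unshelve. all: by end_near.
Qed.

(** If [v] is related to [f], then [k = g - v] satisfies the hypothesis
of [wco_fun_orth_eq0], since [f - w (g o phi)] and [f - T v] are both
orthogonal to the range. Hence [g] and [v] agree where [h] is not 0. Where
[h = 0], both vanish: [g] by the normalization of the pullback, and [v] by
orthogonality to the kernel. *)
Lemma wco_graphP (f v : L2 mu) : reciprocal_graph (@L2_dot d X R mu) T f v <->
  isL2 mu (Efw f) /\ {ae mu, forall x, v x = Efw f x}.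
Proof.
have [mG G0 wGL GP] := wco_pullback_condexpP f.
split=> [[Tv kv rv]|[GL vG]].
  have wvL : isL2 mu (wco_fun phi w v) := Tv.
  have mv := measurable_L2 v.
  have vE : {ae mu, forall x, (f - T v : L2 mu) x = f x - wco_fun phi w v x}.
    by move: (L2B_ae f (T v)) (wco_ae Tv); apply: filterS2 => x -> ->.
  have fv := (wco_orth_ranP mv wvL vE).1 rv.
  pose k x := Efw f x - v x.
  have wkE : wco_fun phi w k =
      fun x => wco_fun phi w (Efw f) x - wco_fun phi w v x.
    by apply/funext => x; rewrite /wco_fun mulrBr.
  have wkL : isL2 mu (wco_fun phi w k) by rewrite wkE; exact: isL2B.
  have mk : measurable_fun setT k.
    have mm1 : measurable_fun setT (fun _ : X => -1 : R[i]) by exact: measurable_cst.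
    have := cmeasurableD mG (cmeasurableM mm1 mv).
    by congr measurable_fun; apply/funext => x; rewrite !fctE mulN1r.
  have k0 : {ae m, forall x, k (phi x) = 0}.
    apply: wco_fun_orth_eq0 => // u Tu.
    have iv := isL2_mul_conj (isL2B (L2_reprP f) wvL) Tu.
    have ik := isL2_mul_conj wkL Tu.
    have iG := isL2_mul_conj (isL2B (L2_reprP f) wGL) Tu.
    apply: (addIr (cintegral mu setT (fun x =>
      (f x - wco_fun phi w (Efw f) x) * Num.conj (wco_fun phi w u x)))).
    rewrite -cintegralD// add0r (GP _ (measurable_L2 u) Tu) -[RHS](fv u Tu).
    congr cintegral; apply/funext => x; rewrite -mulrDl wkE; congr (_ * _).
    by rewrite [LHS]addrC subrKA.
  have {k0}k0 : {ae m, forall x, Efw f (phi x) = v (phi x)}.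
    by apply: filterS k0 => x /eqP; rewrite subr_eq0 => /eqP.
  have vG : {ae mu, forall x, v x = Efw f x}.
    have /(wco_comp_ae_eq wd sfnu mG mv) := k0.
    move: (wco_orth_kerP v).1 => /(_ kv) v0.
    move: v0 G0; apply: filterS3 => x v0 G0 Gv.
    by have [hx|/eqP hx] := eqVneq (h x) 0%E; [rewrite v0// G0|rewrite Gv].
  split => //; apply: isL2_ae_eq (L2_reprP v) => //.
  by apply: filterS vG => x ->.
have wvE := wco_fun_ae wd vG.
have Tv : dom T v.
  by apply: isL2_ae_eq wvE wGL; apply: measurable_wco_fun; exact: measurable_L2.
split => //.
  by apply/wco_orth_kerP; move: vG G0; apply: filterS2 => x ->.
apply/(wco_orth_ranP mG wGL).
  have fTE := L2B_ae f (T v); have TvE := wco_ae Tv.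
  by apply: filterS3 fTE TvE wvE => x -> -> ->.
by move=> u Tu; apply: GP; [exact: measurable_L2|exact: Tu].
Qed.

Lemma wco_reciprocal :
  let Cdag := reciprocal (@L2_dot d X R mu) T in
  dom Cdag = [set f : L2 mu | isL2 mu (Efw f)] /\
  (forall f : L2 mu, dom Cdag f -> {ae mu, forall x, (Cdag f : L2 mu) x = Efw f x}).
Proof.
have [domE appE] := reciprocalP (@L2_dot_norm _ _ _ mu) wco_dom_decomposition wco_ran_dense.
split.
  rewrite domE; apply/seteqP; split => f.
    by move=> [v /wco_graphP[]].
  move=> /= fL; exists (L2_of mu (Efw f)); apply/wco_graphP; split => //.
  exact: L2_of_ae.
move=> f; rewrite domE => -[v fv]; rewrite (appE _ _ fv).
by have [] := (wco_graphP f v).1 fv.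
Qed.

End reciprocal_of_wco.

Theorem theorem1 (R : realType) (d : measure_display) (X : measurableType d)
    (mu : {sigma_finite_measure set X -> \bar R})
    (phi : {mfun X >-> X}) (w : {mfun X >-> R[i]})
    (wd : wco_well_defined mu phi w) :
  densely_defined (wco wd) ->
  let Cdag := reciprocal (@L2_dot d X R mu) (wco wd) in
  let Efw := fun f : L2 mu =>
    wco_pullback mu phi w (wco_condexp mu phi w (wdiv w f)) in
  dom Cdag = [set f : L2 mu | isL2 mu (Efw f)] /\
  (forall f : L2 mu, dom Cdag f -> {ae mu, forall x, (Cdag f : L2 mu) x = Efw f x}).
Proof. exact: wco_reciprocal. Qed.
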